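(* Let $>$ be a monomial-center ordering on $Disgp[X]$ and $D=Disgp[X|S]$, where $S=\{(\lfloor u_i\rfloor_{m_i},\lfloor v_i\rfloor_{n_i})\mid \lfloor u_i\rfloor_{m_i}>\lfloor v_i\rfloor_{n_i},\ i\in I\}\subseteq Disgp[X]\times Disgp[X]$. Then the set $Irr(S^{comp})$ is a set of normal forms of elements of the commutative disemigroup $D$ (i.e. each element of $D$ is represented by exactly one element of $Irr(S^{comp})$), where $S^{comp}$ is a Gröbner--Shirshov basis in $Di[X]$ obtained by the Buchberger--Shirshov algorithm from $S$, regarded as the set $\{\lfloor u_i\rfloor_{m_i}-\lfloor v_i\rfloor_{n_i}\mid i\in I\}\subseteq Di[X]$.
   Context: A commutative disemigroup is a set with two operations $\vdash,\dashv$, each associative and commutative, satisfying $a\dashv(b\vdash c)=a\dashv(b\dashv c)$, $(a\dashv b)\vdash c=(a\vdash b)\vdash c$, $a\vdash(b\dashv c)=(a\vdash b)\dashv c$. Let $X$ be a totally ordered set, $\lfloor X^+\rfloor$ the free commutative semigroup without unit on $X$ (elements $\lfloor u\rfloor$, length $|u|$), $\lfloor X^*\rfloor=\lfloor X^+\rfloor\cup\{\varepsilon\}$. Let $\lfloor X^+\rfloor_1=\{\lfloor u\rfloor_1\mid\lfloor u\rfloor\in\lfloor X^+\rfloor\}$ and $\lfloor XX\rfloor_2=\{\lfloor v\rfloor_2\mid\lfloor v\rfloor\in\lfloor X^+\rfloor,|v|=2\}$ (formal symbols); $x\in X$ is identified with $\lfloor x\rfloor_1$. $Disgp[X]:=\lfloor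 X^+\rfloor_1\cup\lfloor XX\rfloor_2$ is the free commutative disemigroup on $X$, with operations: for $x,x'\in X$, $x\dashv x'=\lfloor xx'\rfloor_1$, $x\vdash x'=\lfloor xx'\rfloor_2$; and if $|uv|>2$, $\lfloor u\rfloor_p\vdash\lfloor v\rfloor_q=\lfloor u\rfloor_p\dashv\lfloor v\rfloor_q=\lfloor uv\rfloor_1$. $Disgp[X|S]:=Disgp[X]/\rho(S)$, where $\rho(S)$ is the congruence of $Disgp[X]$ generated by $S$. Fix a field $\mathbf{k}$; $Di[X]$ (free commutative dialgebra) is the $\mathbf{k}$-space with basis $Disgp[X]$, operations extended bilinearly. An ideal is a subspace closed under $\vdash$- and $\dashv$-multiplication with arbitrary elements; $Id(S)$ is the ideal generated by $S$. Ordering. A monomial ordering on $\lfloor X^+\rfloor$ is a well (total) ordering with $\lfloor u\rfloor>\lfloor v\rfloor\Rightarrow\lfloor uw\rfloor>\lfloor vw\rfloor$. The associated monomial-center ordering on $Disgp[X]$ is: $\lfloor u\rfloor_m>\lfloor v\rfloor_n$ iff $(\lfloor u\rfloor,m)>(\lfloor v\rfloor,n)$ lexicographically. For nonzero $f\in Di[X]$: $supp(f)$ is the set of basis elements occurring with nonzero coefficient; $\overline f$ its largest element (leading monomial), $lc(f)$ its coefficient; $\widetilde f\in\lfloor X^+\rfloor$ is the word $\lfloor u\rfloor$ if $\overline f=\lfloor u\rfloor_m$; $r_f=f-lc(f)\overline f$. Convention: $\overline 0=\widetilde 0=0$ is smaller than everything. $f$ is monic if $lc(f)=1$; a set is monic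 if all its elements are. $f\ne0$ is strong if $\widetilde f>\widetilde{r_f}$. Normal polynomials. For a monic set $S$ the normal $S$-polynomials (normal $s$-polynomials, $s\in S$) $\lfloor sb\rfloor_m$ ($\lfloor b\rfloor\in\lfloor X^*\rfloor$, $m\in\{1,2\}$) are: $\lfloor sb\rfloor_m=s$ if $b=\varepsilon$ ($m$ being the index of $\overline s$); $\lfloor sb\rfloor_2=s\vdash b$ if $|\widetilde s|=1$ and $b\in X$; $\lfloor sb\rfloor_1=s\dashv\lfloor b\rfloor_1$ if $s$ is strong and $\lfloor b\rfloor\in\lfloor X^+\rfloor$. $Irr(S)$ is the set of elements of $Disgp[X]$ that are not the leading monomial of any normal $S$-polynomial. Compositions of monic $f,g\in Di[X]$: (i) if $f$ is not strong, for each $x\in X$, $f\vdash x$ and $f\dashv x$; (ii) if $f$ is strong, $|\widetilde f|>1$ and $supp(f)\cap X\ne\emptyset$, for each $x\in X$, $(f\vdash x)-(f\dashv x)$; (iii) if $f\neq g$, $\overline f=\overline g$: $f-g$; (iv) if $|\widetilde f|=2$, $|\widetilde g|=1$ and there is a normal $g$-polynomial $\lfloor gx\rfloor_m$, $x\in X$, with $\overline f=\overline{\lfloor gx\rfloor_m}$: $f-\lfloor gx\rfloor_m$; (v) if $f,g$ are strong, $|\widetilde f|+|\widetilde g|>3$, $\overline f\ne\overline g$: when $\widetilde f=\widetilde g$, for each $x\in X$, $\lfloor fx\rfloor_1-\lfloor gx\rfloor_1$; when $\widetilde f\neq\widetilde g$ and $lcm\{\widetilde f,\widetilde g\}=\lfloor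 w\rfloor=\lfloor\widetilde fa\rfloor=\lfloor\widetilde gb\rfloor$ with $\lfloor a\rfloor\in\lfloor X^*\rfloor$, $\lfloor b\rfloor\in\lfloor X^+\rfloor$, $|w|<|\widetilde f|+|\widetilde g|$: $\lfloor fa\rfloor_1-\lfloor gb\rfloor_1$. $h\in Di[X]$ is trivial modulo $S$ if $h=\sum_i\alpha_i\lfloor s_ib_i\rfloor_{m_i}$ (finite sum, $\alpha_i\in\mathbf{k}$, normal $S$-polynomials) with $\overline{\lfloor s_ib_i\rfloor_{m_i}}\le\overline h$ whenever $\alpha_i\ne0$. A monic set $S$ is a Gröbner--Shirshov basis in $Di[X]$ if every composition of polynomials in $S$ is trivial modulo $S$. Buchberger--Shirshov algorithm: starting from a monic set $S$, add to it all its nontrivial compositions (those not trivial modulo the current set, made monic), and continue this process repeatedly; the union $S^{comp}$ of the sets obtained is a Gröbner--Shirshov basis containing $S$ with $Id(S^{comp})=Id(S)$. *)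

(* Defs.v *)
From HB Require Import structures.
From mathcomp Require Import all_boot all_order all_algebra.
From mathcomp Require Import generic_quotient.
From mathcomp Require Import finmap multiset monalg.
From mathcomp Require Import boolp classical_sets.

Set Implicit Arguments.
Unset Strict Implicit.
Unset Printing Implicit Defensive.

Import GRing.Theory.

Local Open Scope quotient_scope.
Local Open Scope mset_scope.
Local Open Scope ring_scope.

Section CommutativeDisemigroups.

Record comm_disemigroup (T : Type) (vd dv : T -> T -> T) : Prop :=
  CommDisemigroup {
    vdA : associative vd;
    vdC : commutative vd;
    dvA : associative dv;
    dvC : commutative dv;
    dv_vd : forall a b c, dv a (vd b c) = dv a (dv b c);
    vd_dv : forall a b c, vd (dv a b) c = vd (vd a b) c;
    vd_dvA : forall a b c, vd a (dv b c) = dv (vd a b) c }.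

Record congruence (T : Type) (vd dv : T -> T -> T) (R : T -> T -> Prop) :
    Prop := Congruence {
  cong_refl : forall a, R a a;
  cong_sym : forall a b, R a b -> R b a;
  cong_trans : forall a b c, R a b -> R b c -> R a c;
  cong_vd : forall a a' b b', R a a' -> R b b' -> R (vd a b) (vd a' b');
  cong_dv : forall a a' b b', R a a' -> R b b' -> R (dv a b) (dv a' b') }.

End CommutativeDisemigroups.

Section FreeCommutativeDisemigroup.
Variable X : choiceType.

(* The free commutative monoid on X is {mset X}, with the sum of multisets as
   product and mset0 as the empty word; csg is the free commutative semigroup
   without unit.  The length of a word w is size w, multiplicities included
   (#|w| would count the distinct letters). *)
Record csg := Csg { csg_val :> {mset X}; _ : csg_val != mset0 }.

HB.instance Definition _ := [isSub for csg_val].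
HB.instance Definition _ := [Choice of csg by <:].

Fact csg_mul_subproof (u v : csg) : msetD u v != mset0.
Proof.
apply/negP => /eqP e; case: u e => u /= /negP nu e; apply: nu; apply/eqP.
apply/msetP => x; have /msetP/(_ x) := e.
by rewrite msetE2 mset0E => /eqP; rewrite addn_eq0 => /andP[/eqP ->].
Qed.

Definition csg_mul (u v : csg) : csg := Csg (csg_mul_subproof u v).

Fact letter_subproof (x : X) : msetn 1 x != mset0.
Proof.
by apply/negP => /eqP /msetP/(_ x); rewrite msetnE mset0E eqxx.
Qed.

Definition letter (x : X) : csg := Csg (letter_subproof x).

(* The pair (w, m) encodes the formal symbol w with centre m. *)
Record disgp := Disgp {
  disgp_val : csg * nat;
  _ : (disgp_val.2 == 1%N) ||
      (disgp_val.2 == 2%N) && (size disgp_val.1 == 2%N) }.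

HB.instance Definition _ := [isSub for disgp_val].
HB.instance Definition _ := [Choice of disgp by <:].

Definition word (a : disgp) : csg := (disgp_val a).1.
Definition center (a : disgp) : nat := (disgp_val a).2.

Fact dg1_subproof (w : csg) :
  ((w, 1%N).2 == 1%N) || ((w, 1%N).2 == 2%N) && (size (w, 1%N).1 == 2%N).
Proof. by []. Qed.

Definition dg1 (w : csg) : disgp := Disgp (dg1_subproof w).

(* The symbol with centre 2 when w has length 2, and dg1 w otherwise. *)
Definition dg2 (w : csg) : disgp := insubd (dg1 w) (w, 2%N).

Definition dvash (a b : disgp) : disgp := dg1 (csg_mul (word a) (word b)).
Definition vdash (a b : disgp) : disgp := dg2 (csg_mul (word a) (word b)).

Lemma word_dg2 w : word (dg2 w) = w.
Proof.
rewrite /word /dg2 /insubd; case: insubP => //= a _ e.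
exact: (congr1 fst e).
Qed.

Lemma center_dg2 w : center (dg2 w) = if size w == 2%N then 2%N else 1%N.
Proof.
rewrite /center /dg2 /insubd; case: insubP => /= [a -> e|/negbTE -> //].
by rewrite (congr1 snd e).
Qed.

Lemma csg_mulA : associative csg_mul.
Proof. by move=> u v w; apply: val_inj; rewrite /= msetDA. Qed.

Lemma csg_mulC : commutative csg_mul.
Proof. by move=> u v; apply: val_inj; rewrite /= msetDC. Qed.

Lemma size_csg_gt0 (u : csg) : (0 < size u)%N.
Proof.
by case: u => u /= nu; rewrite lt0n size_mset_eq0.
Qed.

Lemma size_csg_mul (u v : csg) : size (csg_mul u v) = (size u + size v)%N.
Proof.
have /perm_size -> : perm_eq (msetD u v) (u ++ v).
  by apply/allP => x _; rewrite /= count_cat !count_mem_mset msetE2.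
by rewrite size_cat.
Qed.

Lemma dg2_long u v w :
  dg2 (csg_mul (csg_mul u v) w) = dg1 (csg_mul (csg_mul u v) w).
Proof.
have e : (size (csg_mul (csg_mul u v) w) == 2%N) = false.
  apply/negbTE; rewrite !size_csg_mul neq_ltn orbC.
  by rewrite (leq_add (leq_add (size_csg_gt0 u) (size_csg_gt0 v))
                      (size_csg_gt0 w)).
by rewrite /dg2 /insubd insubF // -[RHS]e.
Qed.

Lemma disgp_comm_disemigroup : comm_disemigroup vdash dvash.
Proof.
split; rewrite /vdash /dvash.
- by move=> a b c; rewrite !word_dg2 csg_mulA.
- by move=> a b; rewrite csg_mulC.
- by move=> a b c; rewrite /= csg_mulA.
- by move=> a b; rewrite csg_mulC.
- by move=> a b c; rewrite word_dg2.
- by move=> a b c; rewrite word_dg2.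
- by move=> a b c; rewrite word_dg2 /= csg_mulA dg2_long.
Qed.

Definition rho (S : set (disgp * disgp)) (a b : disgp) : Prop :=
  forall R : disgp -> disgp -> Prop, congruence vdash dvash R ->
    (forall p, S p -> R p.1 p.2) -> R a b.

Lemma rho_congruence S : congruence vdash dvash (rho S).
Proof.
split.
- by move=> a R cR _; apply: cong_refl cR _.
- by move=> a b ab R cR SR; apply: cong_sym cR _ _ (ab R cR SR).
- move=> a b c ab bc R cR SR.
  exact: cong_trans cR _ _ _ (ab R cR SR) (bc R cR SR).
- move=> a a' b b' aa bb R cR SR.
  exact: cong_vd cR _ _ _ _ (aa R cR SR) (bb R cR SR).
- move=> a a' b b' aa bb R cR SR.
  exact: cong_dv cR _ _ _ _ (aa R cR SR) (bb R cR SR).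
Qed.

Definition rhob S : rel disgp := fun a b => `[< rho S a b >].

Lemma rhob_refl S : reflexive (rhob S).
Proof. by move=> a; apply/asboolP; apply: cong_refl (rho_congruence S) _. Qed.

Lemma rhob_sym S : symmetric (rhob S).
Proof.
by move=> a b; apply/asboolP/asboolP; apply: cong_sym (rho_congruence S) _ _.
Qed.

Lemma rhob_trans S : transitive (rhob S).
Proof.
move=> b a c /asboolP ab /asboolP bc; apply/asboolP.
exact: cong_trans (rho_congruence S) _ _ _ ab bc.
Qed.

Definition rho_equiv S : equiv_rel disgp :=
  EquivRel (rhob S) (@rhob_refl S) (@rhob_sym S) (@rhob_trans S).

Definition disgp_pres S := {eq_quot rho_equiv S}.

Section Presentation.
Variable S : set (disgp * disgp).

Definition pres_pi (a : disgp) : disgp_pres S := \pi_(disgp_pres S) a.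

Definition pres_vdash (c d : disgp_pres S) : disgp_pres S :=
  pres_pi (vdash (repr c) (repr d)).
Definition pres_dvash (c d : disgp_pres S) : disgp_pres S :=
  pres_pi (dvash (repr c) (repr d)).

Lemma pres_piP a b : pres_pi a = pres_pi b <-> rho S a b.
Proof.
split=> [/eqmodP /asboolP //|ab]; apply/eqmodP; exact/asboolP.
Qed.

Lemma rho_repr a : rho S (repr (pres_pi a)) a.
Proof. by apply/pres_piP; rewrite /pres_pi reprK. Qed.

Lemma pres_vdashE a b :
  pres_vdash (pres_pi a) (pres_pi b) = pres_pi (vdash a b).
Proof.
by apply/pres_piP; apply: cong_vd (rho_congruence S) _ _ _ _ _ _;
  apply: rho_repr.
Qed.

Lemma pres_dvashE a b :
  pres_dvash (pres_pi a) (pres_pi b) = pres_pi (dvash a b).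
Proof.
by apply/pres_piP; apply: cong_dv (rho_congruence S) _ _ _ _ _ _;
  apply: rho_repr.
Qed.

Lemma pres_comm_disemigroup : comm_disemigroup pres_vdash pres_dvash.
Proof.
have pK c : exists a, c = pres_pi a by exists (repr c); rewrite /pres_pi reprK.
have [A1 C1 A2 C2 H1 H2 H3] := disgp_comm_disemigroup.
have E := (pres_vdashE, pres_dvashE).
split=> [a b c|a b|a b c|a b|a b c|a b c|a b c];
  have [{}a ->] := pK a; have [{}b ->] := pK b; try (have [{}c ->] := pK c);
  by rewrite !E; congr pres_pi.
Qed.

End Presentation.

Record monomial_ordering (lt : rel csg) : Prop := MonomialOrdering {
  mo_irr : irreflexive lt;
  mo_trans : transitive lt;
  mo_total : forall u v, u != v -> lt u v || lt v u;
  mo_wf : well_founded (fun u v => lt u v);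
  mo_mul : forall u v w, lt v u -> lt (csg_mul v w) (csg_mul u w) }.

Definition mc_lt (lt : rel csg) : rel disgp := fun a b =>
  lt (word a) (word b) || (word a == word b) && (center a < center b)%N.

End FreeCommutativeDisemigroup.

(* None plays the role of the leading monomial and word of 0. *)
Definition olt (T : Type) (lt : rel T) : rel (option T) := fun a b =>
  match a, b with
  | Some x, Some y => lt x y
  | None, Some _ => true
  | _, None => false
  end.

Definition ole (T : eqType) (lt : rel T) : rel (option T) := fun a b =>
  (a == b) || olt lt a b.

Definition omaxr (T : Type) (lt : rel T) (a b : option T) : option T :=
  if olt lt a b then b else a.

Section Dialgebra.
Variables (X : choiceType) (k : fieldType).

Local Notation Di := {malg k[disgp X]}.

Definition di_bilin (op : disgp X -> disgp X -> disgp X) (f g : Di) : Di :=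
  \sum_(a <- msupp f) \sum_(b <- msupp g) << f@_a * g@_b *g op a b >>.

Definition di_vdash : Di -> Di -> Di := di_bilin (@vdash X).
Definition di_dvash : Di -> Di -> Di := di_bilin (@dvash X).

Definition di1 (w : csg X) : Di := << dg1 w >>.

Definition binomials (S : set (disgp X * disgp X)) : set Di :=
  [set << p.1 >> - << p.2 >> | p in S]%classic.

Variable lt : rel (csg X).

Definition lm (f : Di) : option (disgp X) :=
  \big[omaxr (mc_lt lt)/None]_(a <- msupp f) Some a.

Definition lc (f : Di) : k := if lm f is Some a then f@_a else 0.

Definition lw (f : Di) : option (csg X) := omap (@word X) (lm f).

Definition lwsize (f : Di) : nat := if lw f is Some w then size w else 0.

Definition rest (f : Di) : Di :=
  if lm f is Some a then f - << lc f *g a >> else f.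

Definition monic (f : Di) : Prop := lc f = 1.

Definition strong (f : Di) : Prop := f != 0 /\ olt lt (lw (rest f)) (lw f).

(* normal s b m p: there is a normal s-polynomial with right factor b and
   index m, and it is equal to p.  It is meant for monic s. *)
Inductive normal (s : Di) : {mset X} -> nat -> Di -> Prop :=
| normal_nil a : lm s = Some a -> normal s mset0 (center a) s
| normal_two x : lwsize s = 1%N ->
    normal s (letter x) 2 (di_vdash s (di1 (letter x)))
| normal_one (b : csg X) : strong s -> normal s b 1 (di_dvash s (di1 b)).

Definition normal_in (S : set Di) (p : Di) : Prop :=
  exists s b m, S s /\ normal s b m p.

Definition Irr (S : set Di) : set (disgp X) :=
  [set a | ~ exists2 p, normal_in S p & lm p = Some a]%classic.

(* The cases on a single polynomial do not mention g.  msetU is the least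
   common multiple of two words.  In comp_lcm the index of normal f a 1 p is
   automatically 1 when a is empty: f then has leading word msetU u v, which
   has length 2 only if v is a letter, against the bound on the lengths. *)
Inductive composition (f g : Di) : Di -> Prop :=
| comp_weak_vdash x : ~ strong f ->
    composition f g (di_vdash f (di1 (letter x)))
| comp_weak_dvash x : ~ strong f ->
    composition f g (di_dvash f (di1 (letter x)))
| comp_letter x y : strong f -> (1 < lwsize f)%N ->
    dg1 (letter y) \in msupp f ->
    composition f g
      (di_vdash f (di1 (letter x)) - di_dvash f (di1 (letter x)))
| comp_same : f != g -> lm f = lm g -> composition f g (f - g)
| comp_incl x m p : lwsize f = 2%N -> lwsize g = 1%N ->
    normal g (letter x) m p -> lm f = lm p -> composition f g (f - p)
| comp_word x p q : strong f -> strong g -> (3 < lwsize f + lwsize g)%N ->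
    lm f != lm g -> lw f = lw g ->
    normal f (letter x) 1 p -> normal g (letter x) 1 q ->
    composition f g (p - q)
| comp_lcm (u v : csg X) (a : {mset X}) (b : csg X) p q :
    strong f -> strong g -> (3 < lwsize f + lwsize g)%N -> lm f != lm g ->
    lw f = Some u -> lw g = Some v -> u != v ->
    msetU u v = msetD u a -> msetU u v = msetD v b ->
    (size (msetU u v) < size u + size v)%N ->
    normal f a 1 p -> normal g b 1 q -> composition f g (p - q).

Definition composition_in (S : set Di) (h : Di) : Prop :=
  exists f g, S f /\ S g /\ composition f g h.

Definition trivial_mod (S : set Di) (h : Di) : Prop :=
  exists (n : nat) (c : 'I_n -> k) (p : 'I_n -> Di),
    [/\ forall i, normal_in S (p i),
        forall i, c i != 0 -> ole (mc_lt lt) (lm (p i)) (lm h)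
      & h = \sum_(i < n) c i *: p i].

Definition gs_basis (S : set Di) : Prop :=
  (forall f, S f -> monic f) /\
  (forall h, composition_in S h -> trivial_mod S h).

Definition bs_step (S : set Di) : set Di :=
  (S `|` [set (lc h)^-1 *: h | h in
            [set h | composition_in S h /\ ~ trivial_mod S h]])%classic.

Definition bs_stage (S : set Di) (n : nat) : set Di := iter n bs_step S.

Definition bs_comp (S : set Di) : set Di :=
  [set f | exists n, bs_stage S n f]%classic.

Lemma bs_stageS S m n : (m <= n)%N -> (bs_stage S m `<=` bs_stage S n)%classic.
Proof.
by move=> /subnK <-; elim: (n - m)%N => // i IHi f /IHi Sf; left.
Qed.

Lemma normal_inS S T p : (S `<=` T)%classic -> normal_in S p -> normal_in T p.
Proof.
by move=> ST [s [b [m [Ss np]]]]; exists s, b, m; split=> //; apply: ST.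
Qed.

Lemma trivial_modS S T h :
  (S `<=` T)%classic -> trivial_mod S h -> trivial_mod T h.
Proof.
move=> ST [n [c [p [np le_ph hE]]]]; exists n, c, p.
by split=> // i; apply: normal_inS ST (np i).
Qed.

Lemma lm_supp f a : lm f = Some a -> a \in msupp f.
Proof.
rewrite /lm big_seq; elim/big_ind: _ => //; last by move=> b ? [<-].
by rewrite /omaxr => x y Hx Hy; case: ifP.
Qed.

Lemma big_omaxr_None (r : seq (disgp X)) :
  \big[omaxr (mc_lt lt)/None]_(a <- r) Some a = None -> r = [::].
Proof.
case: r => // a r; rewrite big_cons /omaxr.
by case: (\big[_/_]_(_ <- _) _) => //= b; case: ifP.
Qed.

Lemma lm_None f : lm f = None -> f = 0.
Proof.
move=> /big_omaxr_None f0; apply/malgP => a.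
by rewrite mcoeff0 mcoeff_outdom // -[a \in _]/(a \in enum_fset _) f0.
Qed.

Lemma lm_max f a b : monomial_ordering lt -> lm f = Some a ->
  b \in msupp f -> ole (mc_lt lt) (Some b) (Some a).
Proof.
move=> lt_mo.
have trans : transitive (mc_lt lt).
  move=> y x z /orP[xy|/andP[/eqP xy cxy]] /orP[yz|/andP[/eqP yz cyz]];
    rewrite /mc_lt.
  - by rewrite (mo_trans lt_mo xy yz).
  - by rewrite -yz xy.
  - by rewrite xy yz.
  - by rewrite xy yz eqxx (ltn_trans cxy cyz) orbT.
have total x y : x != y -> mc_lt lt x y || mc_lt lt y x.
  move=> nxy; rewrite /mc_lt.
  have [wxy|/(mo_total lt_mo)] := eqVneq (word x) (word y).
    rewrite wxy (mo_irr lt_mo) /= -neq_ltn.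
    apply: contra nxy => /eqP cxy; apply/eqP/val_inj.
    by rewrite [LHS]surjective_pairing [RHS]surjective_pairing; congr pair.
  by case/orP=> ->; rewrite ?orbT.
have aux (r : seq (disgp X)) : b \in r -> forall a,
    \big[omaxr (mc_lt lt)/None]_(c <- r) Some c = Some a ->
    ole (mc_lt lt) (Some b) (Some a).
  elim: r => // c r IHr; rewrite inE => br d; rewrite big_cons /omaxr.
  case E: (\big[_/_]_(_ <- r) _) => [e|] /=; last first.
    case=> <-; move: br; rewrite (big_omaxr_None E) in_nil orbF.
    by move=> /eqP ->; rewrite /ole eqxx.
  case: ifP => ce [<-]; case/orP: br => [/eqP ->|/IHr/(_ _ E)] //.
  - by rewrite /ole /= ce orbT.
  - by rewrite /ole eqxx.
  - move=> /orP[/eqP[->]|/= be]; rewrite /ole /=.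
      case: (eqVneq e c) => [->|/total]; first by rewrite eqxx.
      by rewrite ce orbF => ->; rewrite orbT.
    case: (eqVneq e c) => [<-|/total]; first by rewrite be orbT.
    by rewrite ce orbF => ec; rewrite (trans _ _ _ be ec) orbT.
by move=> fa bf; apply: aux bf _ fa.
Qed.

Lemma lmZ (c : k) f : c != 0 -> lm (c *: f) = lm f.
Proof.
move=> c0; rewrite /lm; congr (\big[_/_]_(_ <- enum_fset _) _).
by apply/fsetP => a; rewrite -!mcoeff_neq0 mcoeffZ mulf_eq0 negb_or c0.
Qed.

Lemma lcZ (c : k) f : c != 0 -> lc (c *: f) = c * lc f.
Proof.
by move=> c0; rewrite /lc lmZ //; case: (lm f) => [a|]; rewrite ?mcoeffZ ?mulr0.
Qed.

Lemma lc_neq0 f : f != 0 -> lc f != 0.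
Proof.
move=> f0; rewrite /lc; case E: (lm f) => [a|].
  by rewrite mcoeff_neq0; apply: lm_supp E.
by rewrite (lm_None E) eqxx in f0.
Qed.

Lemma trivial_mod0 S : trivial_mod S 0.
Proof.
exists 0%N, (fun=> 0), (fun=> 0); split; try by case.
by rewrite big_ord0.
Qed.

Lemma bs_comp_gs_basis S : (forall f, S f -> monic f) -> gs_basis (bs_comp S).
Proof.
move=> Sm; split.
  move=> f [n]; elim: n f => [//|n IHn] f /= [/IHn //|[h [_ h_nt] <-]].
  have lc0 : lc h != 0.
    by apply/lc_neq0/eqP => h0; apply: h_nt; rewrite h0; apply: trivial_mod0.
  by rewrite /monic lcZ ?invr_eq0 // mulVf.
move=> h [f [g [[m Sf] [[n Sg] fgh]]]].
have [h_t|h_nt] := pselect (trivial_mod (bs_stage S (maxn m n)) h).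
  by apply: trivial_modS h_t => p Sp; exists (maxn m n).
have h0 : h != 0 by apply/eqP => h0; apply: h_nt; rewrite h0; apply: trivial_mod0.
have lc0 := lc_neq0 h0.
case E: (lm h) => [a|]; last by rewrite (lm_None E) eqxx in h0.
exists 1%N, (fun=> lc h), (fun=> (lc h)^-1 *: h); split.
- move=> _; exists ((lc h)^-1 *: h), mset0, (center a); split.
    exists (maxn m n).+1; right; exists h => //; split=> //.
    exists f, g; split; first exact: bs_stageS (leq_maxl m n) _ Sf.
    by split; first exact: bs_stageS (leq_maxr m n) _ Sg.
  by apply: normal_nil; rewrite lmZ ?invr_eq0.
- by move=> _ _; rewrite lmZ ?invr_eq0 // /ole eqxx.
- by rewrite big_ord1 scalerA divff // scale1r.
Qed.

End Dialgebra.

Arguments binomials {X} k S.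

(* Main.v *)
From HB Require Import structures.
Require Import Defs.
From mathcomp Require Import all_boot all_order all_algebra.
From mathcomp Require Import finmap multiset monalg.
From mathcomp Require Import boolp classical_sets.

Set Implicit Arguments.
Unset Strict Implicit.
Unset Printing Implicit Defensive.

Import GRing.Theory.

Local Open Scope mset_scope.
Local Open Scope ring_scope.

(** Two elements of Disgp[X] are congruent when their difference lies in the
    ideal generated by the binomials of S, so the theorem is a statement about
    this ideal and its Groebner-Shirshov basis T obtained by completion.

    Uniqueness.  Let N be the span of the normal T-polynomials.  It is stable
    under both products by words ([normal_at_dv], [normal_at_vd]), hence the
    relation a - b in N is a congruence; it contains S, and therefore rho S
    ([rho_nspan]).  By the Composition-Diamond lemma ([composition_diamond]) the
    leading monomial of a nonzero element of N is that of a normal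
    T-polynomial.  For distinct congruent a and b this makes a or b reducible.

    The Composition-Diamond lemma follows Buchberger.  By well-founded
    induction it comes down to [normal_at_sub_nspan]: two normal polynomials
    with the same leading monomial a differ by a combination of normal
    polynomials with leading monomials smaller than a.  If the leading words of
    the two elements of T involved are coprime, this is an identity
    ([coprime_dv_nspan], [coprime_vd_nspan]).  Otherwise the difference is a
    composition times a word ([one_one_nspan]), and compositions are trivial.
    Multiplication by the word keeps the bounds, because p times u is a
    combination of normal polynomials with leading words at most the leading
    word of p times u; the compositions of a single polynomial ensure this.

    Existence.  Completion stays inside the span of the differences a - b with
    rho S a b ([bs_comp_congruence_ideal]), so the sum of the coefficients over
    a congruence class vanishes on every normal T-polynomial.  Reducing
    monomials by well-founded induction, it would vanish everywhere if the
    class contained no irreducible element ([Irr_exists]). *)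

(** * Subspaces and linear maps *)

Section Subspaces.
Variables (k : fieldType) (V : lmodType k).

Definition subspace (W : V -> Prop) : Prop :=
  W 0 /\ forall (c : k) (u v : V), W u -> W v -> W (c *: u + v).

(** The intersection of the subspaces containing P: proving something of a
    whole span is then one instantiation of W. *)
Definition span (P : V -> Prop) (v : V) : Prop :=
  forall W, subspace W -> (forall p, P p -> W p) -> W v.

Section Closure.
Variables (W : V -> Prop) (subW : subspace W).

Lemma subspace0 : W 0. Proof. by case: subW. Qed.

Lemma subspaceZ c u : W u -> W (c *: u).
Proof.
by move=> Wu; rewrite -[_ *: _]addr0; apply: subW.2 => //; apply: subspace0.
Qed.

Lemma subspaceD u v : W u -> W v -> W (u + v).
Proof. by move=> Wu Wv; rewrite -[u]scale1r; apply: subW.2. Qed.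

Lemma subspaceN u : W u -> W (- u).
Proof. by rewrite -scaleN1r; apply: subspaceZ. Qed.

Lemma subspaceB u v : W u -> W v -> W (u - v).
Proof. by move=> Wu Wv; apply: subspaceD => //; apply: subspaceN. Qed.

Lemma subspace_sum (I : Type) (r : seq I) (Q : pred I) (F : I -> V) :
  (forall i, Q i -> W (F i)) -> W (\sum_(i <- r | Q i) F i).
Proof.
by move=> WF; apply: big_ind WF; [apply: subspace0|apply: subspaceD].
Qed.

End Closure.

Lemma zero_subspace : subspace (fun v : V => v = 0).
Proof. by split=> // c u v -> ->; rewrite scaler0 addr0. Qed.

Lemma span_subspace P : subspace (span P).
Proof.
split=> [W [W0 _] _ //|c u v Pu Pv W subW PW].
by apply: subW.2; [apply: Pu|apply: Pv].
Qed.

Lemma span_min P (W : V -> Prop) :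
  subspace W -> (forall p, P p -> W p) -> forall v, span P v -> W v.
Proof. by move=> subW PW v; apply. Qed.

Lemma span_gen P p : P p -> span P p.
Proof. by move=> Pp W _; apply. Qed.

End Subspaces.

Lemma linear_zero (k : fieldType) (V V' : lmodType k) (F : V' -> V) :
  linear F -> F 0 = 0.
Proof.
move=> linF; have := linF 1 0 0.
by rewrite !scale1r addr0 -[X in X = _]addr0 => /addrI.
Qed.

Lemma linear_sub (k : fieldType) (V V' : lmodType k) (F : V' -> V) u v :
  linear F -> F (u - v) = F u - F v.
Proof. by move=> linF; rewrite addrC -scaleN1r linF scaleN1r addrC. Qed.

Lemma subspace_comp (k : fieldType) (V V' : lmodType k) (F : V' -> V)
    (W : V -> Prop) : linear F -> subspace W -> subspace (fun v => W (F v)).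
Proof.
move=> linF subW; split=> [|c u v Wu Wv]; last by rewrite linF; apply: subW.2.
by rewrite linear_zero //; apply: subspace0.
Qed.

(** * Linear maps on a monoid algebra *)

(** The basis element << a >>, locked like the products below: comparing two
    distinct monomials must not unfold finitely supported functions. *)
HB.lock Definition mono (k : fieldType) (K : choiceType) (a : K) :
  {malg k[K]} := << a >>.
Canonical mono_unlockable := Unlockable mono.unlock.
Arguments mono {k K} a.

Section MonoidAlgebra.
Variables (k : fieldType) (K : choiceType).
Implicit Types (f g : {malg k[K]}) (a b : K).

Definition supp_in (A : K -> Prop) f : Prop := forall b, b \in msupp f -> A b.

Lemma supp_in_subspace A : subspace (supp_in A).
Proof.
split=> [b|c f g fA gA b]; first by rewrite -mcoeff_neq0 mcoeff0 eqxx.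
rewrite -mcoeff_neq0 mcoeffD mcoeffZ => nz.
have [fb|fb] := eqVneq f@_b 0; last by apply: fA; rewrite -mcoeff_neq0.
by apply: gA; rewrite -mcoeff_neq0; move: nz; rewrite fb mulr0 add0r.
Qed.

Lemma supp_inU (A : K -> Prop) a : A a -> supp_in A (mono a).
Proof.
move=> Aa b; rewrite -mcoeff_neq0 unlock mcoeffU.
by have [<- //|_] := eqVneq a b; rewrite mulr0n eqxx.
Qed.

Lemma supp_in_sub (A B : K -> Prop) f :
  (forall b, A b -> B b) -> supp_in A f -> supp_in B f.
Proof. by move=> AB fA b /fA /AB. Qed.

Lemma malgUZ (c : k) a : << c *g a >> = c *: mono a :> {malg k[K]}.
Proof.
apply/malgP => b; rewrite unlock mcoeffZ !mcoeffU.
by case: eqP; rewrite ?mulr1n ?mulr0n ?mulr1 ?mulr0.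
Qed.

Section LinearExtension.
Variable V : lmodType k.

Definition lext (F : K -> V) f : V := \sum_(a <- msupp f) f@_a *: F a.

(** Summing over a set larger than the support makes linearity a termwise
    computation. *)
Lemma lextw (F : K -> V) f (d : {fset K}) :
  (msupp f `<=` d)%fset -> lext F f = \sum_(a <- d) f@_a *: F a.
Proof.
move=> le_fd; rewrite /lext (big_fset_incl _ le_fd) // => a _ /mcoeff_outdom ->.
by rewrite scale0r.
Qed.

Lemma lext_linear (F : K -> V) : linear (lext F).
Proof.
move=> c f g; set d := (msupp f `|` msupp g)%fset.
rewrite !(@lextw F _ d) ?fsubsetUl ?fsubsetUr //.
  rewrite scaler_sumr -big_split /=; apply: eq_bigr => a _.
  by rewrite mcoeffD mcoeffZ scalerDl scalerA.
by apply: fsubset_trans (msuppD_le _ _) _; apply: fsetSU; apply: msuppZ_le.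
Qed.

Lemma lextU (F : K -> V) a : lext F (mono a) = F a.
Proof.
rewrite unlock (@lextw F _ [fset a]%fset) ?msuppU_le // big_seq_fset1.
by rewrite mcoeffUU scale1r.
Qed.

(** A linear map is determined by its values on the basis, so the identities
    between products below are all checked on monomials. *)
Lemma lextE (F : {malg k[K]} -> V) :
  linear F -> F =1 lext (fun a => F (mono a)).
Proof.
move=> linF f; pose W v := F v = lext (fun a => F (mono a)) v.
have subW : subspace W.
  split=> [|c u v]; last by rewrite /W linF lext_linear => -> ->.
  by rewrite /W !linear_zero //; apply: lext_linear.
rewrite -/(W f) [f]monalgE; apply: (subspace_sum subW) => a _.
by rewrite malgUZ; apply: (subspaceZ subW); rewrite /W lextU.
Qed.

Lemma eq_linear_malg (F G : {malg k[K]} -> V) : linear F -> linear G ->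
  (forall a, F (mono a) = G (mono a)) -> F =1 G.
Proof.
move=> linF linG FG f; rewrite (lextE linF) (lextE linG).
by apply: eq_bigr => a _; rewrite FG.
Qed.

Lemma linear_supp (F : {malg k[K]} -> V) (W : V -> Prop) (A : K -> Prop) f :
  linear F -> subspace W -> supp_in A f ->
  (forall a, A a -> W (F (mono a))) -> W (F f).
Proof.
move=> linF subW fA FA; rewrite (lextE linF) /lext big_seq.
by apply: (subspace_sum subW) => a /fA /FA; apply: (subspaceZ subW).
Qed.

End LinearExtension.
End MonoidAlgebra.

Arguments supp_in_subspace {k K} A.
Arguments span_subspace {k V} P.
Arguments zero_subspace {k} V.

(** * Bilinear extension of the operations *)

Section Bilinear.
Variables (X : choiceType) (k : fieldType).
Local Notation Di := {malg k[disgp X]}.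
Variable op : disgp X -> disgp X -> disgp X.

Lemma di_bilinE (f g : Di) :
  di_bilin op f g = lext (fun a => lext (fun b => mono (op a b)) g : Di) f.
Proof.
rewrite /di_bilin /lext; apply: eq_bigr => a _; rewrite scaler_sumr.
by apply: eq_bigr => b _; rewrite malgUZ scalerA.
Qed.

Lemma di_bilin_linearl (g : Di) : linear (fun f => di_bilin op f g).
Proof. by move=> c f f'; rewrite !di_bilinE lext_linear. Qed.

Lemma di_bilin_linearr (f : Di) : linear (di_bilin op f).
Proof.
move=> c g g'; rewrite !di_bilinE /lext scaler_sumr -big_split /=.
apply: eq_bigr => a _; rewrite -/(lext _ _) lext_linear scalerDr !scalerA.
by rewrite mulrC.
Qed.

Lemma di_bilinUU a b : di_bilin op (mono a) (mono b) = mono (op a b) :> Di.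
Proof. by rewrite di_bilinE !lextU. Qed.

Lemma di_bilinC (f g : Di) :
  commutative op -> di_bilin op f g = di_bilin op g f.
Proof.
move=> opC; move: f; apply: eq_linear_malg.
- exact: di_bilin_linearl.
- exact: di_bilin_linearr.
move=> a; move: g; apply: eq_linear_malg.
- exact: di_bilin_linearr.
- exact: di_bilin_linearl.
by move=> b; rewrite !di_bilinUU opC.
Qed.

End Bilinear.

(** * Words *)

Local Notation "u · v" := (csg_mul u v) (at level 40, left associativity).

Section Words.
Variable X : choiceType.
Implicit Types (u v w : csg X) (a b : disgp X).

Lemma disgp_inj a b : word a = word b -> center a = center b -> a = b.
Proof.
move=> wab cab; apply: val_inj.
by rewrite [LHS]surjective_pairing [RHS]surjective_pairing; congr pair.
Qed.

Lemma center_le2 a : (0 < center a <= 2)%N.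
Proof.
case: a => [[w m] p]; rewrite /center /=.
by case/orP: p => [/eqP|/andP[/eqP]] /= ->.
Qed.

Lemma center_size a : center a <> 1%N -> size (word a) = 2%N.
Proof.
case: a => [[w m] p]; rewrite /center /word /=.
by case/orP: p => [/eqP|/andP[_ /eqP]].
Qed.

Lemma center_size1 a : size (word a) = 1%N -> center a = 1%N.
Proof. by have [//|/eqP/center_size ->] := eqVneq (center a) 1%N. Qed.

Lemma dg1K a : center a = 1%N -> dg1 (word a) = a.
Proof. by move=> ca; apply: disgp_inj. Qed.

Lemma dg2K a : center a <> 1%N -> dg2 (word a) = a.
Proof.
move=> ca; apply: disgp_inj; first exact: word_dg2.
rewrite center_dg2 center_size //=.
by have := center_le2 a; case: (center a) ca => [|[|[|]]].
Qed.

Lemma dg1_neq_dg2 u w : size w = 2%N -> dg1 u <> dg2 w.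
Proof.
by move=> sw /(congr1 (@center X)); rewrite center_dg2 sw.
Qed.

Lemma dg2E w : size w <> 2%N -> dg2 w = dg1 w.
Proof.
move=> sw; apply: disgp_inj; first exact: word_dg2.
by rewrite center_dg2; case: eqP.
Qed.

Lemma size_msetD (m n : {mset X}) : size (msetD m n) = (size m + size n)%N.
Proof.
have /perm_size -> : perm_eq (msetD m n) (m ++ n).
  by apply/allP => x _; rewrite /= count_cat !count_mem_mset msetE2.
by rewrite size_cat.
Qed.

Lemma msetUI (m n : {mset X}) :
  msetD (msetU m n) (msetI m n) = msetD m n.
Proof.
apply/msetP => x; rewrite !msetE2.
by case: (leqP (m x) (n x)) => _; rewrite // addnC.
Qed.

Lemma size_letter (x : X) : size (letter x) = 1%N.
Proof. by rewrite /= enum_msetn. Qed.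

Lemma size1_letter u : size u = 1%N -> exists x, u = letter x.
Proof.
case: u => m /= nm s1; have [m0|[x xm]] := mset_0Vmem m.
  by case/negP: (nm); rewrite m0.
exists x; apply: val_inj => /=; rewrite -(msetB1K xm).
suff /eqP -> : msetB m (msetn 1 x) == mset0 by rewrite msetD0.
rewrite -size_mset_eq0 -(eqn_add2l 1); apply/eqP.
by rewrite -{1}(size_letter x) -size_msetD msetB1K.
Qed.

Lemma csg_letter_cases u :
  (exists x, u = letter x) \/ (exists x v, u = letter x · v).
Proof.
case: u => m nm; have [m0|[x xm]] := mset_0Vmem m.
  by case/negP: (nm); rewrite m0.
have [B0|nB] := eqVneq (msetB m (msetn 1 x)) mset0.
  left; exists x; apply: val_inj => /=.
  by rewrite -(msetB1K xm) B0 msetD0.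
by right; exists x, (Csg nB); apply: val_inj; rewrite /= msetB1K.
Qed.

(** Two factorisations of a word of length 2 agree up to exchanging the
    letters. *)
Lemma letter_mul_eq (x y x' y' : X) :
  letter y · letter x = letter y' · letter x' ->
  letter y = letter y' /\ letter x = letter x' \/
  letter y = letter x' /\ letter x = letter y'.
Proof.
move=> /(congr1 (@csg_val X)) /= e.
have [yy'|ny] := eqVneq y y'.
  left; rewrite yy' in e *; split=> //.
  have := congr1 (msetB^~ (msetn 1 y')) e; rewrite !msetDKB => ex.
  exact: val_inj.
right.
have yx' : y = x'.
  have : y \in msetD (msetn 1 y') (msetn 1 x').
    by rewrite -e in_msetD in_mset1 eqxx.
  by rewrite in_msetD !in_mset1 (negbTE ny) => /eqP.
rewrite yx' in e *; split=> //; apply: val_inj => /=.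
have := congr1 (msetB^~ (msetn 1 x')) e.
by rewrite msetDKB msetDC msetDKB.
Qed.

Lemma csg_mulI u v w : u · v = u · w -> v = w.
Proof.
move=> /(congr1 (@csg_val X)) /= e; apply: val_inj.
by have := congr1 (msetB^~ (csg_val u)) e; rewrite !msetDKB.
Qed.

Lemma size_mul_gt u v : (size u < size (u · v))%N.
Proof.
by rewrite size_csg_mul -[X in (X < _)%N]addn0 ltn_add2l size_csg_gt0.
Qed.

End Words.

(** * Products of polynomials by words *)

HB.lock Definition mul_dvash (X : choiceType) (k : fieldType)
    (f g : {malg k[disgp X]}) : {malg k[disgp X]} := di_dvash f g.
Arguments mul_dvash {X k}.

HB.lock Definition mul_vdash (X : choiceType) (k : fieldType)
    (f g : {malg k[disgp X]}) : {malg k[disgp X]} := di_vdash f g.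
Arguments mul_vdash {X k}.

(** The monomial on the right of a product matters only through its word, so
    products by monomials are written with a word as right factor. *)
HB.lock Definition dv (X : choiceType) (k : fieldType)
    (f : {malg k[disgp X]}) (b : csg X) : {malg k[disgp X]} :=
  di_dvash f (di1 k b).
Arguments dv {X k}.

HB.lock Definition vd (X : choiceType) (k : fieldType)
    (f : {malg k[disgp X]}) (b : csg X) : {malg k[disgp X]} :=
  di_vdash f (di1 k b).
Arguments vd {X k}.

Local Notation "f ⊣ b" := (dv f b) (at level 40, left associativity).
Local Notation "f ⊢ b" := (vd f b) (at level 40, left associativity).

(** Used with x = fg, y = f b and z = g a, where a and b are the leading
    monomials of f and g. *)
Lemma cross_sub (V : zmodType) (x y z : V) : y - z = (x - z) - (x - y).
Proof. by rewrite opprB [RHS]addrC subrKA. Qed.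

Section WordProducts.
Variables (X : choiceType) (k : fieldType).
Local Notation Di := {malg k[disgp X]}.
Implicit Types (f g : Di) (u v w b c : csg X).

Lemma di1E b : di1 k b = mono (dg1 b).
Proof. by rewrite unlock. Qed.

Lemma dvE f b : di_dvash f (di1 k b) = f ⊣ b.
Proof. by rewrite dv.unlock. Qed.

Lemma vdE f b : di_vdash f (di1 k b) = f ⊢ b.
Proof. by rewrite vd.unlock. Qed.

Lemma dv_linear b : linear (fun f : Di => f ⊣ b).
Proof. by move=> c f g; rewrite -!dvE [LHS]di_bilin_linearl. Qed.

Lemma vd_linear b : linear (fun f : Di => f ⊢ b).
Proof. by move=> c f g; rewrite -!vdE [LHS]di_bilin_linearl. Qed.

Lemma dvB f g b : (f - g) ⊣ b = f ⊣ b - g ⊣ b.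
Proof. exact: (linear_sub f g (dv_linear b)). Qed.

Lemma vdB f g b : (f - g) ⊢ b = f ⊢ b - g ⊢ b.
Proof. exact: (linear_sub f g (vd_linear b)). Qed.

Lemma dvU (a : disgp X) b : mono a ⊣ b = mono (dg1 (word a · b)) :> Di.
Proof. by rewrite -?dvE -?vdE di1E [LHS]di_bilinUU. Qed.

Lemma vdU (a : disgp X) b : mono a ⊢ b = mono (dg2 (word a · b)) :> Di.
Proof. by rewrite -?dvE -?vdE di1E [LHS]di_bilinUU. Qed.

Lemma linear_comp (V : lmodType k) (F : Di -> Di) (G : Di -> V) :
  linear F -> linear G -> linear (fun f => G (F f)).
Proof. by move=> linF linG c f g; rewrite linF linG. Qed.

Lemma dv_dv f b c : f ⊣ b ⊣ c = f ⊣ (b · c).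
Proof.
move: f; apply: eq_linear_malg => [||a].
- exact: linear_comp (dv_linear b) (dv_linear c).
- exact: dv_linear.
by rewrite !dvU /= csg_mulA.
Qed.

Lemma vd_dv f b c : f ⊢ b ⊣ c = f ⊣ (b · c).
Proof.
move: f; apply: eq_linear_malg => [||a].
- exact: linear_comp (vd_linear b) (dv_linear c).
- exact: dv_linear.
by rewrite vdU !dvU word_dg2 csg_mulA.
Qed.

(** In a product of three monomials the word is longer than 2, which leaves
    only the center 1. *)
Lemma dv_vd f b c : f ⊣ b ⊢ c = f ⊣ (b · c).
Proof.
move: f; apply: eq_linear_malg => [||a].
- exact: linear_comp (dv_linear b) (vd_linear c).
- exact: dv_linear.
by rewrite !dvU vdU /= csg_mulA -dg2_long.
Qed.

Lemma vd_vd f b c : f ⊢ b ⊢ c = f ⊣ (b · c).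
Proof.
move: f; apply: eq_linear_malg => [||a].
- exact: linear_comp (vd_linear b) (vd_linear c).
- exact: dv_linear.
by rewrite !vdU dvU word_dg2 csg_mulA -dg2_long.
Qed.

Lemma vd_long f b c : f ⊢ (b · c) = f ⊣ (b · c).
Proof.
move: f; apply: eq_linear_malg => [||a]; first exact: vd_linear.
  exact: dv_linear.
by rewrite vdU dvU csg_mulA dg2_long.
Qed.

(** The two products of monomials differ only on a pair of letters. *)
Lemma vd_eq_dv f b :
  supp_in (fun a => size (word a) <> 1%N) f -> f ⊢ b = f ⊣ b.
Proof.
move=> fA; apply/eqP; rewrite -subr_eq0; apply/eqP.
have linF : linear (fun g : Di => g ⊢ b - g ⊣ b).
  move=> c g h; rewrite (vd_linear b c g h) (dv_linear b c g h).
  by rewrite scalerBr opprD addrACA.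
apply: (linear_supp linF (zero_subspace _) fA) => a sa.
rewrite vdU dvU dg2E ?subrr // size_csg_mul.
have := size_csg_gt0 (word a); have := size_csg_gt0 b.
case: (size (word a)) sa => [|[|n]] // _; case: (size b) => // m _ _.
by rewrite addSn addnS.
Qed.

(** Product by a possibly empty word, for the cofactors of a least common
    multiple, one of which may be trivial. *)
Definition dvo f (m : {mset X}) : Di := if insub m is Some b then f ⊣ b else f.

Lemma dvo0 f : dvo f mset0 = f.
Proof. by rewrite /dvo insubF // eqxx. Qed.

Lemma dvo_csg f u : dvo f u = f ⊣ u.
Proof. by rewrite /dvo valK. Qed.

Variant dvo_spec f : {mset X} -> Di -> Type :=
| DvoNil : dvo_spec f mset0 f
| DvoCsg u : dvo_spec f u (f ⊣ u).

Lemma dvoP f (m : {mset X}) : dvo_spec f m (dvo f m).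
Proof.
have [->|nm] := eqVneq m mset0; first by rewrite dvo0; constructor.
by rewrite -[m]/(csg_val (Csg nm)) dvo_csg; constructor.
Qed.

Lemma dvoD f (m n : {mset X}) : dvo f (msetD m n) = dvo (dvo f m) n.
Proof.
case: (dvoP f m) => [|u]; first by rewrite mset0D.
case: (dvoP (f ⊣ u) n) => [|v]; first by rewrite msetD0 dvo_csg.
by rewrite dv_dv -dvo_csg.
Qed.

Lemma dvoB f g (m : {mset X}) : dvo (f - g) m = dvo f m - dvo g m.
Proof. by rewrite /dvo; case: insubP => // u _ _; rewrite dvB. Qed.

Lemma mul_dvashC f g : mul_dvash f g = mul_dvash g f.
Proof.
by rewrite mul_dvash.unlock; apply: di_bilinC => a b; rewrite /dvash csg_mulC.
Qed.

Lemma mul_dvash_linear f : linear (mul_dvash f).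
Proof. by rewrite mul_dvash.unlock; apply: di_bilin_linearr. Qed.

Lemma mul_dvashB f g h : mul_dvash f (g - h) = mul_dvash f g - mul_dvash f h.
Proof. exact: (linear_sub g h (mul_dvash_linear f)). Qed.

Lemma mul_dvash_word f (a : disgp X) : mul_dvash f (mono a) = f ⊣ word a.
Proof.
move: f; apply: eq_linear_malg => [||b]; [|exact: dv_linear|].
  by rewrite mul_dvash.unlock; apply: di_bilin_linearl.
by rewrite dvU mul_dvash.unlock [LHS]di_bilinUU.
Qed.

Lemma mul_vdashC f g : mul_vdash f g = mul_vdash g f.
Proof.
by rewrite mul_vdash.unlock; apply: di_bilinC => a b; rewrite /vdash csg_mulC.
Qed.

Lemma mul_vdash_linear f : linear (mul_vdash f).
Proof. by rewrite mul_vdash.unlock; apply: di_bilin_linearr. Qed.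

Lemma mul_vdashB f g h : mul_vdash f (g - h) = mul_vdash f g - mul_vdash f h.
Proof. exact: (linear_sub g h (mul_vdash_linear f)). Qed.

Lemma mul_vdash_word f (a : disgp X) : mul_vdash f (mono a) = f ⊢ word a.
Proof.
move: f; apply: eq_linear_malg => [||b]; [|exact: vd_linear|].
  by rewrite mul_vdash.unlock; apply: di_bilin_linearl.
by rewrite vdU mul_vdash.unlock [LHS]di_bilinUU.
Qed.

End WordProducts.

(** * Monomial-center orderings *)

Section Orderings.
Variables (X : choiceType) (lt : rel (csg X)).
Hypothesis lt_mo : monomial_ordering lt.
Local Notation mlt := (mc_lt lt).
Implicit Types (u v w : csg X) (a b c : disgp X).

Lemma lt_mulr u v w : lt u v -> lt (u · w) (v · w).
Proof. exact: mo_mul. Qed.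

Lemma mc_irr a : ~ mlt a a.
Proof. by rewrite /mc_lt (mo_irr lt_mo) ltnn andbF. Qed.

Lemma mc_trans : transitive mlt.
Proof.
move=> b a c /orP[ab|/andP[/eqP ab cab]] /orP[bc|/andP[/eqP bc cbc]];
  rewrite /mc_lt.
- by rewrite (mo_trans lt_mo ab bc).
- by rewrite -bc ab.
- by rewrite ab bc.
- by rewrite ab bc eqxx (ltn_trans cab cbc) orbT.
Qed.

Lemma mc_total a b : a = b \/ mlt a b \/ mlt b a.
Proof.
have [wab|/(mo_total lt_mo)/orP[ab|ab]] := eqVneq (word a) (word b).
- have [ab|ab|ab] := ltngtP (center a) (center b).
  + by right; left; rewrite /mc_lt wab eqxx ab orbT.
  + by right; right; rewrite /mc_lt wab eqxx ab orbT.
  + by left; apply: disgp_inj.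
- by right; left; rewrite /mc_lt ab.
- by right; right; rewrite /mc_lt ab.
Qed.

Lemma mc_word a b : lt (word a) (word b) -> mlt a b.
Proof. by rewrite /mc_lt => ->. Qed.

Lemma mc_word_le a b : mlt a b -> word a = word b \/ lt (word a) (word b).
Proof. by case/orP=> [|/andP[/eqP]]; [right|left]. Qed.

Lemma mc_wf : well_founded (fun a b => mlt a b).
Proof.
suff accW w : forall n a, word a = w -> center a = n ->
    Acc (fun a b => mlt a b) a.
  by move=> a; apply: accW.
elim/(well_founded_ind (mo_wf lt_mo)): w => w IHw.
elim/ltn_ind => n IHn a aw an; constructor => b /orP[ba|/andP[/eqP ba cba]].
  by apply: IHw (word b) _ _ _ _ _ => //; rewrite -aw.
by apply: IHn (center b) _ _ _ _ => //; rewrite -?an // ba.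
Qed.

Definition word_lt w a : Prop := lt (word a) w.
Definition word_le w a : Prop := word a = w \/ lt (word a) w.

Lemma word_lt_down w a b : mlt a b -> word_lt w b -> word_lt w a.
Proof.
by rewrite /word_lt => /mc_word_le[-> //|ab bw]; apply: mo_trans ab bw.
Qed.

Lemma word_le_down w a b : mlt a b -> word_le w b -> word_le w a.
Proof.
rewrite /word_le => /mc_word_le[-> //|ab [bw|bw]]; right; first by rewrite -bw.
exact: mo_trans ab bw.
Qed.

Lemma word_le_mulr w u a b :
  word_le w a -> word_le (word a · u) b -> word_le (w · u) b.
Proof.
rewrite /word_le => aw [->|ba]; case: aw => [<-|aw].
- by left.
- by right; apply: lt_mulr.
- by right.
- by right; apply: (mo_trans lt_mo ba); apply: lt_mulr.
Qed.

Lemma word_lt_mulr w u a b :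
  word_lt w a -> word_le (word a · u) b -> word_lt (w · u) b.
Proof.
rewrite /word_lt => aw [->|ba]; first exact: lt_mulr.
by apply: (mo_trans lt_mo ba); apply: lt_mulr.
Qed.

Lemma word_lt_mull w u a b :
  word_lt w a -> word_le (u · word a) b -> word_lt (u · w) b.
Proof. by rewrite ![u · _]csg_mulC; apply: word_lt_mulr. Qed.

End Orderings.

(** * Leading monomials and normal polynomials *)

Section LeadingMonomials.
Variables (X : choiceType) (k : fieldType) (lt : rel (csg X)).
Hypothesis lt_mo : monomial_ordering lt.
Local Notation Di := {malg k[disgp X]}.
Local Notation mlt := (mc_lt lt).
Implicit Types (f g p : Di) (u v w : csg X) (a b c : disgp X).

(** f is monic with leading monomial a, expressed by the tail f - a so that it
    can be carried along linear maps. *)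
Definition lead a f : Prop := supp_in (fun b => mlt b a) (f - mono a).

(** f is monic and strong with leading monomial a: the tail is bounded by
    words, hence the bound survives multiplication by a word. *)
Definition strong_at a f : Prop :=
  supp_in (fun b => lt (word b) (word a)) (f - mono a).

Lemma mcoeff_mono a b : (mono a : Di)@_b = (b == a)%:R.
Proof. by rewrite eq_sym unlock mcoeffU. Qed.

Lemma lead_coeff a f : lead a f -> f@_a = 1.
Proof.
move=> fa; apply/eqP; rewrite -subr_eq0; apply/eqP.
have := mcoeffB a f (mono a); rewrite mcoeff_mono eqxx => <-.
by apply: mcoeff_outdom; apply/negP => /fa /(mc_irr lt_mo).
Qed.

Lemma supp_subU f a b : b \in msupp f -> b = a \/ b \in msupp (f - mono a).
Proof.
have [->|ba bf] := eqVneq b a; first by left.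
right; rewrite -mcoeff_neq0 mcoeffB mcoeff_mono (negbTE ba) subr0.
by rewrite mcoeff_neq0.
Qed.

Lemma lead_supp a f b : lead a f -> b \in msupp f -> b = a \/ mlt b a.
Proof. by move=> fa /(supp_subU a)[->|/fa]; [left|right]. Qed.

Lemma ole_SomeP a b : ole mlt (Some a) (Some b) -> a = b \/ mlt a b.
Proof. by case/orP=> [/eqP[->]|]; [left|right]. Qed.

Lemma lead_lm a f : lead a f -> lm lt f = Some a.
Proof.
move=> fa; have af : a \in msupp f by rewrite -mcoeff_neq0 lead_coeff ?oner_eq0.
case E: (lm lt f) => [b|]; last first.
  by move: af; rewrite (lm_None E) msupp0.
have [->//|ba] := lead_supp fa (lm_supp E).
have [->//|ab] := ole_SomeP (lm_max lt_mo E af).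
by case: (mc_irr lt_mo (mc_trans lt_mo ab ba)).
Qed.

Lemma monic_lead f : Defs.monic lt f -> exists a, lead a f.
Proof.
rewrite /Defs.monic /lc; case E: (lm lt f) => [a|]; last first.
  by move/esym/eqP; rewrite oner_eq0.
move=> fa1; exists a => b; have [->|ba] := eqVneq b a.
  by rewrite -mcoeff_neq0 mcoeffB mcoeff_mono fa1 eqxx subrr eqxx.
rewrite -mcoeff_neq0 mcoeffB mcoeff_mono (negbTE ba) subr0.
rewrite mcoeff_neq0 => /(lm_max lt_mo E) /ole_SomeP[e|//].
by rewrite e eqxx in ba.
Qed.

Lemma lead_neq0 a f : lead a f -> f != 0.
Proof.
by move=> /lead_lm E; apply/eqP => f0; have := lm_supp E; rewrite f0 msupp0.
Qed.

Lemma lead_lw a f : lead a f -> lw lt f = Some (word a).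
Proof. by move=> /lead_lm E; rewrite /lw E. Qed.

Lemma lead_lwsize a f : lead a f -> lwsize lt f = size (word a).
Proof. by move=> /lead_lw E; rewrite /lwsize E. Qed.

Lemma strong_lead a f : strong_at a f -> lead a f.
Proof. by apply: supp_in_sub => b; apply: mc_word. Qed.

Lemma lead_rest a f : lead a f -> rest lt f = f - mono a.
Proof.
by move=> fa; rewrite /rest /lc (lead_lm fa) (lead_coeff fa) unlock.
Qed.

Lemma strongP a f : lead a f -> strong lt f <-> strong_at a f.
Proof.
move=> fa; rewrite /strong (lead_rest fa) (lead_lw fa) /lw; split.
  case=> _ sf b bf; case E: (lm lt (f - mono a)) sf => [c|] /= sf; last first.
    by move: bf; rewrite (lm_None E) msupp0.
  have [->//|/mc_word_le[->//|bc]] := ole_SomeP (lm_max lt_mo E bf).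
  exact: mo_trans bc sf.
move=> sf; split; first exact: lead_neq0 fa.
by case E: (lm lt (f - mono a)) => [c|] //=; apply: sf; apply: lm_supp E.
Qed.

(** A tail monomial with the same word as the leading one would have a center
    smaller than 1. *)
Lemma center1_strong a f : lead a f -> center a = 1%N -> strong_at a f.
Proof.
move=> fa ca b /fa /orP[//|/andP[_]]; rewrite ca.
by have /andP[] := center_le2 b; case: (center b).
Qed.

Lemma strong_at_dv a f (b : csg X) :
  strong_at a f -> strong_at (dg1 (word a · b)) (f ⊣ b).
Proof.
move=> fa; rewrite /strong_at -dvU -dvB.
apply: (linear_supp (dv_linear b) (supp_in_subspace _) fa) => c lt_ca.
by rewrite dvU; apply: supp_inU; apply: lt_mulr.
Qed.

Lemma strong_at_vd a f (b : csg X) :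
  strong_at a f -> strong_at (dg2 (word a · b)) (f ⊢ b).
Proof.
move=> fa; rewrite /strong_at -vdU -vdB word_dg2.
apply: (linear_supp (vd_linear b) (supp_in_subspace _) fa) => c lt_ca.
by rewrite vdU; apply: supp_inU; rewrite word_dg2; apply: lt_mulr.
Qed.

(** Normal polynomials of a monic set; the leading monomial is an index, so
    that bounds and equality of leading monomials concern indices only. *)
Inductive normal_at (S : set Di) : disgp X -> Di -> Prop :=
| normal_at_elt f a : S f -> lead a f -> normal_at S a f
| normal_at_two f x y : S f -> strong_at (dg1 (letter y)) f ->
    normal_at S (dg2 (letter y · letter x)) (f ⊢ letter x)
| normal_at_one f a (b : csg X) : S f -> strong_at a f ->
    normal_at S (dg1 (word a · b)) (f ⊣ b).

Lemma normal_at_lead S a p : normal_at S a p -> lead a p.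
Proof.
case=> [f b //|f x y _ sf|f b c _ sf]; apply: strong_lead.
  exact: (@strong_at_vd (dg1 (letter y))).
exact: strong_at_dv.
Qed.

Lemma normal_in_at S p : (forall f, S f -> Defs.monic lt f) ->
  normal_in lt S p -> exists a, normal_at S a p.
Proof.
move=> Sm [s [b [m [Ss np]]]]; have [a sa] := monic_lead (Sm s Ss).
case: np => [c _|x s1|{}b ss].
- by exists a; apply: normal_at_elt.
- rewrite vdE; have [y ay] : exists y, word a = letter y.
    by apply: size1_letter; rewrite -(lead_lwsize sa).
  have ca : center a = 1%N.
    by apply: center_size1; rewrite ay size_letter.
  exists (dg2 (letter y · letter x)); apply: normal_at_two => //.
  by rewrite -ay dg1K //; apply: center1_strong.
- rewrite dvE; exists (dg1 (word a · b)).
  by apply: normal_at_one => //; apply/strongP.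
Qed.

Lemma normal_dv s a (b : csg X) : strong_at a s -> normal lt s b 1 (s ⊣ b).
Proof.
by move=> sa; rewrite -dvE; apply: normal_one; apply/(strongP (strong_lead sa)).
Qed.

Lemma normal_vd s x y : strong_at (dg1 (letter y)) s ->
  normal lt s (letter x) 2 (s ⊢ letter x).
Proof.
move=> /strong_lead sa; rewrite -vdE; apply: normal_two.
by rewrite (lead_lwsize sa) size_letter.
Qed.

Lemma normal_at_in S a p : normal_at S a p -> normal_in lt S p.
Proof.
case=> [f b Sf fb|f x y Sf sf|f b c Sf sf].
- by exists f, mset0, (center b); split=> //; apply: normal_nil; apply: lead_lm.
- by exists f, (letter x), 2%N; split=> //; apply: normal_vd sf.
- by exists f, c, 1%N; split=> //; apply: normal_dv sf.
Qed.

End LeadingMonomials.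

(** * The span of the normal polynomials is an ideal *)

Section GroebnerShirshovBasis.
Variables (X : choiceType) (k : fieldType) (lt : rel (csg X)).
Hypothesis lt_mo : monomial_ordering lt.
Local Notation Di := {malg k[disgp X]}.
Local Notation mlt := (mc_lt lt).
Local Notation wlt := (word_lt lt).
Local Notation wle := (word_le lt).
Variable S : set Di.
Hypothesis gsS : gs_basis lt S.
Implicit Types (f g h p q : Di) (u v w : csg X) (a b c : disgp X).

(** Combinations of normal polynomials whose leading monomials satisfy A.  The
    bounds of the classical argument are choices of A. *)
Definition nspan (A : disgp X -> Prop) : Di -> Prop :=
  span (fun p => exists2 a, normal_at lt S a p & A a).

Lemma nspan_subspace A : subspace (nspan A).
Proof. exact: span_subspace. Qed.

Lemma nspan_gen (A : disgp X -> Prop) a p :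
  normal_at lt S a p -> A a -> nspan A p.
Proof. by move=> pa Aa; apply: span_gen; exists a. Qed.

Lemma nspan_ind (A : disgp X -> Prop) (W : Di -> Prop) : subspace W ->
  (forall a p, normal_at lt S a p -> A a -> W p) -> forall h, nspan A h -> W h.
Proof. by move=> subW WA h; apply=> // p [a pa Aa]; apply: WA pa Aa. Qed.

Lemma nspan_sub (A B : disgp X -> Prop) h :
  (forall a, A a -> B a) -> nspan A h -> nspan B h.
Proof.
move=> AB; apply: nspan_ind (nspan_subspace B) _ _ => a p pa /AB.
exact: nspan_gen pa.
Qed.

Lemma gs_monic f : S f -> Defs.monic lt f.
Proof. exact: gsS.1. Qed.

(** A trivial polynomial inherits any bound that holds on its support, because
    its representation stays below its own leading monomial. *)
Lemma trivial_nspan (A : disgp X -> Prop) h :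
  trivial_mod lt S h -> (forall a b, mlt a b -> A b -> A a) -> supp_in A h ->
  nspan A h.
Proof.
move=> [n [c [p [Np le_ph def_h]]]] Adown Ah; rewrite def_h.
apply: (subspace_sum (nspan_subspace A)) => i _.
have [->|ci] := eqVneq (c i) 0.
  by rewrite scale0r; apply: subspace0 (nspan_subspace A).
apply: (subspaceZ (nspan_subspace A)).
have [a pa] := normal_in_at lt_mo gs_monic (Np i).
apply: nspan_gen (pa) _; move: (le_ph i ci).
rewrite (lead_lm lt_mo (normal_at_lead lt_mo pa)).
case E: (lm lt h) => [b|] // /ole_SomeP le_ab.
have Ab : A b by apply: Ah; apply: lm_supp E.
by case: le_ab => [->|/Adown/(_ Ab)].
Qed.

Lemma composition_nspan (A : disgp X -> Prop) f g h :
  S f -> S g -> composition lt f g h -> (forall a b, mlt a b -> A b -> A a) ->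
  supp_in A h -> nspan A h.
Proof.
by move=> Sf Sg fgh; apply: trivial_nspan; apply: gsS.2; exists f, g.
Qed.

Lemma lead_wle a f : lead lt a f -> supp_in (wle (word a)) f.
Proof.
move=> fa b /(lead_supp fa)[->|/mc_word_le]; first by left.
by case; [left|right].
Qed.

Lemma supp_dv w f u : supp_in (wle w) f -> supp_in (wle (w · u)) (f ⊣ u).
Proof.
move=> fw; apply: (linear_supp (dv_linear u) (supp_in_subspace _) fw) => a aw.
by rewrite dvU; apply: supp_inU; apply: (word_le_mulr lt_mo aw); left.
Qed.

Lemma supp_vd w f u : supp_in (wle w) f -> supp_in (wle (w · u)) (f ⊢ u).
Proof.
move=> fw; apply: (linear_supp (vd_linear u) (supp_in_subspace _) fw) => a aw.
rewrite vdU; apply: supp_inU; apply: (word_le_mulr lt_mo aw).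
by left; rewrite word_dg2.
Qed.

(** Only a non-strong element of S causes trouble.  Its product by the first
    letter of u is a composition, hence a combination of normal polynomials,
    and the remaining letters of u are absorbed by induction on the length. *)
Lemma normal_at_dv a p u :
  normal_at lt S a p -> nspan (wle (word a · u)) (p ⊣ u).
Proof.
have [n] := ubnP (size u); elim: n a p u => // n IHn a p u le_un.
case=> [f b Sf fb|f x y Sf sf|f b v Sf sf].
- have [sf|wf] := pselect (strong_at lt b f).
    by apply: nspan_gen (normal_at_one _ Sf sf) _; left.
  have comp_x x : nspan (wle (word b · letter x)) (f ⊣ letter x).
    apply: (@composition_nspan _ f f) => //; last 1 first.
    - by apply: supp_dv; apply: lead_wle.
    - by rewrite -dvE; apply: comp_weak_dvash => /(strongP lt_mo fb).
    - exact: word_le_down.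
  have [[x ->//]|[x [v def_u]]] := csg_letter_cases u.
  rewrite def_u -dv_dv csg_mulA; move: (comp_x x).
  apply: nspan_ind (subspace_comp (dv_linear v) (nspan_subspace _)) _ _.
  move=> c q qc cw; have lt_vn : (size v < n)%N.
    by move: le_un; rewrite def_u size_csg_mul size_letter ltnS.
  by apply: nspan_sub (IHn c q v lt_vn qc) => d; apply: word_le_mulr.
- rewrite vd_dv; apply: nspan_gen (normal_at_one _ Sf sf) _; left.
  by rewrite word_dg2 csg_mulA.
- rewrite dv_dv; apply: nspan_gen (normal_at_one _ Sf sf) _; left.
  by rewrite /= csg_mulA.
Qed.

(** By [vd_long] only a letter x remains.  If f is strong and its leading word
    is not a letter, f ⊢ x differs from the normal polynomial f ⊣ x only when a
    letter occurs in the support of f, and then by a composition. *)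
Lemma normal_at_vd a p u :
  normal_at lt S a p -> nspan (wle (word a · u)) (p ⊢ u).
Proof.
have [[x ->]|[x [v ->]] pa] := csg_letter_cases u; last first.
  by rewrite vd_long; apply: normal_at_dv.
case=> [f b Sf fb|f z y Sf sf|f b v Sf sf].
- have [sf|wf] := pselect (strong_at lt b f); last first.
    apply: (@composition_nspan _ f f) => //; last 1 first.
    - by apply: supp_vd; apply: lead_wle.
    - by rewrite -vdE; apply: comp_weak_vdash => /(strongP lt_mo fb).
    - exact: word_le_down.
  have [/size1_letter[y def_b]|b1] := eqVneq (size (word b)) 1%N.
    have cb : center b = 1%N.
      by apply: center_size1; rewrite def_b size_letter.
    have sy : strong_at lt (dg1 (letter y)) f by rewrite -def_b dg1K.
    rewrite def_b.
    apply: nspan_gen (normal_at_two x Sf sy) _.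
    by left; rewrite word_dg2.
  rewrite -[f ⊢ _](subrK (f ⊣ letter x)).
  apply: (subspaceD (nspan_subspace _)); last first.
    by apply: normal_at_dv; apply: normal_at_elt.
  have [[y yf]|no_letter] := pselect (exists y, dg1 (letter y) \in msupp f).
    apply: (@composition_nspan _ f f) => //; last 1 first.
    - apply: (subspaceB (supp_in_subspace _)).
        by apply: supp_vd; apply: lead_wle.
      by apply: supp_dv; apply: lead_wle.
    - rewrite -vdE -dvE; apply: (@comp_letter _ _ _ _ _ _ y) => //.
        exact/(strongP lt_mo fb).
      rewrite (lead_lwsize lt_mo fb).
      by have := size_csg_gt0 (word b); case: (size (word b)) b1 => [|[]].
    - exact: word_le_down.
  rewrite vd_eq_dv ?subrr; first exact: subspace0 (nspan_subspace _).
  move=> c cf /[dup] c1 /size1_letter[y cy]; apply: no_letter; exists y.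
  rewrite -cy dg1K //.
  by apply: center_size1; rewrite c1.
- rewrite vd_vd; apply: nspan_gen (normal_at_one _ Sf sf) _; left.
  by rewrite word_dg2 csg_mulA.
- rewrite dv_vd; apply: nspan_gen (normal_at_one _ Sf sf) _; left.
  by rewrite /= csg_mulA.
Qed.

Lemma nspan_dv w u h : nspan (wlt w) h -> nspan (wlt (w · u)) (h ⊣ u).
Proof.
have subW := nspan_subspace (wlt (w · u)).
apply: nspan_ind (subspace_comp (dv_linear u) subW) _ _ => a p pa aw.
by apply: nspan_sub (normal_at_dv pa) => b; apply: word_lt_mulr.
Qed.

Lemma nspan_vd w u h : nspan (wlt w) h -> nspan (wlt (w · u)) (h ⊢ u).
Proof.
have subW := nspan_subspace (wlt (w · u)).
apply: nspan_ind (subspace_comp (vd_linear u) subW) _ _ => a p pa aw.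
by apply: nspan_sub (normal_at_vd pa) => b; apply: word_lt_mulr.
Qed.

(** * Normal polynomials with the same leading monomial *)

Lemma supp_lead_sub a p q :
  lead lt a p -> lead lt a q -> supp_in (fun b => mlt b a) (p - q).
Proof.
move=> pa qa; rewrite -[p - q](subrKA (mono a)) -[mono a - q]opprB.
exact: (subspaceB (supp_in_subspace _) pa qa).
Qed.

Lemma supp_strong_sub a p q :
  strong_at lt a p -> strong_at lt a q -> supp_in (wlt (word a)) (p - q).
Proof.
move=> pa qa; rewrite -[p - q](subrKA (mono a)) -[mono a - q]opprB.
exact: (subspaceB (supp_in_subspace _) pa qa).
Qed.

Lemma same_strong_nspan f g a : S f -> S g -> strong_at lt a f ->
  strong_at lt a g -> nspan (wlt (word a)) (f - g).
Proof.
move=> Sf Sg fa ga; have [->|nfg] := eqVneq f g.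
  by rewrite subrr; apply: subspace0 (nspan_subspace _).
apply: (@composition_nspan _ f g) => //.
- apply: comp_same => //.
  by rewrite (lead_lm lt_mo (strong_lead fa)) (lead_lm lt_mo (strong_lead ga)).
- exact: word_lt_down.
- exact: supp_strong_sub.
Qed.

Lemma same_nspan f g a : S f -> S g -> lead lt a f -> lead lt a g ->
  nspan (fun b => mlt b a) (f - g).
Proof.
move=> Sf Sg fa ga; have [->|nfg] := eqVneq f g.
  by rewrite subrr; apply: subspace0 (nspan_subspace _).
apply: (@composition_nspan _ f g) => //.
- by apply: comp_same => //; rewrite (lead_lm lt_mo fa) (lead_lm lt_mo ga).
- by move=> b c bc; apply: mc_trans.
- exact: supp_lead_sub.
Qed.

(** Applied to the tail f of another polynomial, this puts the product
    strictly below that of the leading words. *)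
Lemma tail_dv_nspan g b w f : S g -> lead lt b g -> supp_in (wlt w) f ->
  nspan (wlt (word b · w)) (mul_dvash g f).
Proof.
move=> Sg gb fw.
apply: (linear_supp (mul_dvash_linear g) (nspan_subspace _) fw) => c cw.
rewrite mul_dvash_word.
apply: nspan_sub (normal_at_dv (normal_at_elt Sg gb)) => d.
exact: word_lt_mull.
Qed.

Lemma tail_vd_nspan g b w f : S g -> lead lt b g -> supp_in (wlt w) f ->
  nspan (wlt (word b · w)) (mul_vdash g f).
Proof.
move=> Sg gb fw.
apply: (linear_supp (mul_vdash_linear g) (nspan_subspace _) fw) => c cw.
rewrite mul_vdash_word.
apply: nspan_sub (normal_at_vd (normal_at_elt Sg gb)) => d.
exact: word_lt_mull.
Qed.

(** With f = a + r and g = b + t, commutativity gives f b - g a = g r - f t: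
    no composition is needed for coprime leading words. *)
Lemma coprime_dv_nspan f g a b : S f -> S g -> strong_at lt a f ->
  strong_at lt b g -> nspan (wlt (word a · word b)) (f ⊣ word b - g ⊣ word a).
Proof.
move=> Sf Sg fa gb; rewrite -!mul_dvash_word (cross_sub (mul_dvash f g)).
rewrite {1}[mul_dvash f g]mul_dvashC -!mul_dvashB.
apply: (subspaceB (nspan_subspace _)).
  by rewrite csg_mulC; apply: tail_dv_nspan fa => //; apply: strong_lead.
by apply: tail_dv_nspan gb => //; apply: strong_lead.
Qed.

Lemma coprime_vd_nspan f g a b : S f -> S g -> strong_at lt a f ->
  strong_at lt b g -> nspan (wlt (word a · word b)) (f ⊢ word b - g ⊢ word a).
Proof.
move=> Sf Sg fa gb; rewrite -!mul_vdash_word (cross_sub (mul_vdash f g)).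
rewrite {1}[mul_vdash f g]mul_vdashC -!mul_vdashB.
apply: (subspaceB (nspan_subspace _)).
  by rewrite csg_mulC; apply: tail_vd_nspan fa => //; apply: strong_lead.
by apply: tail_vd_nspan gb => //; apply: strong_lead.
Qed.

(** Two letters y and y' are equal or coprime, so the only overlap is a
    composition of f and g themselves. *)
Lemma two_two_nspan f g (x y x' y' : X) : S f -> S g ->
  strong_at lt (dg1 (letter y)) f -> strong_at lt (dg1 (letter y')) g ->
  letter y · letter x = letter y' · letter x' ->
  nspan (wlt (letter y · letter x)) (f ⊢ letter x - g ⊢ letter x').
Proof.
move=> Sf Sg fy gy' e; have [[yy' xx']|[yx' xy']] := letter_mul_eq e.
  rewrite -xx' -vdB; rewrite -yy' in gy'; apply: (@nspan_vd (letter y)).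
  exact: same_strong_nspan fy gy'.
by rewrite -yx' xy'; apply: coprime_vd_nspan fy gy'.
Qed.

Lemma elt_two_nspan f g a (x y : X) : S f -> S g -> lead lt a f ->
  strong_at lt (dg1 (letter y)) g -> a = dg2 (letter y · letter x) ->
  nspan (fun b => mlt b a) (f - g ⊢ letter x).
Proof.
move=> Sf Sg fa gy def_a.
have gxa : lead lt a (g ⊢ letter x).
  rewrite def_a; apply: strong_lead.
  exact: (@strong_at_vd _ _ _ _ (dg1 (letter y))).
apply: (@composition_nspan _ f g) => //; last exact: supp_lead_sub.
  apply: (@comp_incl _ _ _ _ _ x 2).
  - by rewrite (lead_lwsize lt_mo fa) def_a word_dg2 size_csg_mul !size_letter.
  - by rewrite (lead_lwsize lt_mo (strong_lead gy)) size_letter.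
  - exact: normal_vd gy.
  - by rewrite (lead_lm lt_mo fa) (lead_lm lt_mo gxa).
by move=> b c bc; apply: mc_trans.
Qed.

(** The leading word of g divides that of f.  For lengths 2 and 1 this is an
    inclusion composition, otherwise the least common multiple is the leading
    word of f. *)
Lemma elt_one_nspan f g a b u : S f -> S g -> lead lt a f -> strong_at lt b g ->
  a = dg1 (word b · u) -> nspan (fun c => mlt c a) (f - g ⊣ u).
Proof.
move=> Sf Sg fa gb def_a.
have wa : word a = word b · u by rewrite def_a.
have gua : strong_at lt a (g ⊣ u) by rewrite def_a; apply: strong_at_dv.
have ca : center a = 1%N by rewrite def_a.
have sf : strong_at lt a f by apply: center1_strong.
have sgtb : (size (word b) < size (word a))%N by rewrite wa size_mul_gt.
apply: (@composition_nspan _ f g) => //; last 1 first.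
- by apply: supp_lead_sub => //; apply: strong_lead.
- have sb0 := size_csg_gt0 (word b).
  have [le3|gt3] := leqP (size (word a) + size (word b)) 3.
    have [sa sb] : size (word a) = 2%N /\ size (word b) = 1%N.
      by move: sgtb sb0 le3; case: (size (word b)) => [|[|[|n]]] //;
        case: (size (word a)) => [|[|[|m]]]; rewrite ?addnS.
    have su : size u = 1%N.
      by move: sa; rewrite wa size_csg_mul sb => -[].
    have [x def_u] := size1_letter su.
    apply: (@comp_incl _ _ _ _ _ x 1).
    + by rewrite (lead_lwsize lt_mo fa).
    + by rewrite (lead_lwsize lt_mo (strong_lead gb)).
    + by rewrite def_u; apply: normal_dv gb.
    + by rewrite (lead_lm lt_mo fa) (lead_lm lt_mo (strong_lead gua)).
  have le_ba : msubset (word b) (word a).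
    by rewrite wa; apply/msubsetP => x; rewrite /= msetE2 leq_addr.
  have UE : msetU (word a) (word b) = word a by apply/msetUidPl.
  apply: (@comp_lcm _ _ _ _ _ (word a) (word b) mset0 u).
  + exact/(strongP lt_mo fa).
  + exact/(strongP lt_mo (strong_lead gb)).
  + by rewrite (lead_lwsize lt_mo fa) (lead_lwsize lt_mo (strong_lead gb)).
  + rewrite (lead_lm lt_mo fa) (lead_lm lt_mo (strong_lead gb)).
    by apply/eqP => -[ab]; rewrite ab ltnn in sgtb.
  + by rewrite (lead_lw lt_mo fa).
  + by rewrite (lead_lw lt_mo (strong_lead gb)).
  + by apply/eqP => ab; rewrite ab ltnn in sgtb.
  + by rewrite UE msetD0.
  + by rewrite UE wa.
  + by rewrite UE -[X in (X < _)%N]addn0 ltn_add2l.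
  + by rewrite -ca; apply: normal_nil; apply: lead_lm.
  + exact: normal_dv gb.
- by move=> c d cd; apply: mc_trans.
Qed.

Lemma nspan_dvo w w' h (m : {mset X}) : csg_val w' = msetD w m ->
  nspan (wlt w) h -> nspan (wlt w') (dvo h m).
Proof.
move=> def_w'; case: dvoP def_w' => [|u] def_w'.
  by rewrite (_ : w' = w) //; apply: val_inj; rewrite /= def_w' msetD0.
by rewrite (_ : w' = w · u); [apply: nspan_dv|apply: val_inj].
Qed.

(** Distinct monomials with the same word have centers 1 and 2, so the word has
    length 2 and the length condition on compositions holds. *)
Lemma same_word_nspan f g a b u : S f -> S g -> strong_at lt a f ->
  strong_at lt b g -> word a = word b ->
  nspan (wlt (word a · u)) (f ⊣ u - g ⊣ u).
Proof.
move=> Sf Sg fa gb wab; have [ab|nab] := eqVneq a b.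
  rewrite -dvB; apply: nspan_dv; apply: same_strong_nspan => //.
  by rewrite ab.
have comp_x x :
    nspan (wlt (word a · letter x)) (f ⊣ letter x - g ⊣ letter x).
  apply: (@composition_nspan _ f g) => //; last 1 first.
  - apply: (@supp_strong_sub (dg1 (word a · letter x))).
      exact: strong_at_dv.
    by rewrite wab; apply: strong_at_dv.
  - apply: (@comp_word _ _ _ _ _ x).
    + exact/(strongP lt_mo (strong_lead fa)).
    + exact/(strongP lt_mo (strong_lead gb)).
    + rewrite (lead_lwsize lt_mo (strong_lead fa)).
      rewrite (lead_lwsize lt_mo (strong_lead gb)) -wab.
      have -> // : size (word a) = 2%N.
      have [ca|/eqP/center_size//] := eqVneq (center a) 1%N.
      have [cb|/eqP/center_size] := eqVneq (center b) 1%N; last by rewrite wab.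
      by case/eqP: nab; apply: disgp_inj; rewrite ?ca.
    + rewrite (lead_lm lt_mo (strong_lead fa)) (lead_lm lt_mo (strong_lead gb)).
      by apply: contra nab => /eqP[->].
    + rewrite (lead_lw lt_mo (strong_lead fa)) (lead_lw lt_mo (strong_lead gb)).
      by rewrite wab.
    + exact: normal_dv fa.
    + exact: normal_dv gb.
  - exact: word_lt_down.
have [[x ->//]|[x [v ->]]] := csg_letter_cases u.
by rewrite -!dv_dv -dvB csg_mulA; apply: nspan_dv.
Qed.

(** The lengths 2 and 1 fall short of the bound for least common multiples;
    the inclusion composition takes over, with the product chosen according to
    the center of the leading monomial of f. *)
Lemma divides_nspan f g a b (z : X) u : S f -> S g -> strong_at lt a f ->
  strong_at lt b g -> size (word b) = 1%N -> word a = word b · letter z ->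
  nspan (wlt (word a · u)) (f ⊣ u - g ⊣ (letter z · u)).
Proof.
move=> Sf Sg fa gb sb wab.
have sa : size (word a) = 2%N by rewrite wab size_csg_mul sb size_letter.
have incl m p : normal lt g (letter z) m p -> strong_at lt a p ->
    nspan (wlt (word a)) (f - p).
  move=> gp pa; apply: (@composition_nspan _ f g) => //; last 1 first.
  - exact: supp_strong_sub.
  - apply: comp_incl gp _.
    + by rewrite (lead_lwsize lt_mo (strong_lead fa)).
    + by rewrite (lead_lwsize lt_mo (strong_lead gb)).
    + rewrite (lead_lm lt_mo (strong_lead fa)).
      by rewrite (lead_lm lt_mo (strong_lead pa)).
  - exact: word_lt_down.
have [ca|/eqP ca] := eqVneq (center a) 1%N.
  rewrite -dv_dv -dvB; apply: nspan_dv; apply: (incl 1%N).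
    exact: normal_dv gb.
  by rewrite -(dg1K ca) wab; apply: strong_at_dv.
rewrite -vd_dv -dvB; apply: nspan_dv; apply: (incl 2%N).
  have [y wb] := size1_letter sb; apply: (@normal_vd _ _ _ _ _ _ y) => //.
  rewrite -wb dg1K //.
  by apply: center_size1; rewrite sb.
by rewrite -(dg2K ca) wab; apply: strong_at_vd.
Qed.

(** Buchberger's argument: the common multiple w of both leading words is the
    least one L times a word c, and the difference is the one for L multiplied
    by c.  The latter is a composition, or the leading words are coprime. *)
Lemma one_one_nspan f g a b u v : S f -> S g -> strong_at lt a f ->
  strong_at lt b g -> word a · u = word b · v ->
  nspan (wlt (word a · u)) (f ⊣ u - g ⊣ v).
Proof.
(* With the shorter leading word second, its cofactor b0 in L is nonempty. *)
wlog le_ba : f g a b u v / (size (word b) <= size (word a))%N.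
  move=> IH Sf Sg fa gb e.
  have [le_ba|/ltnW le_ab] := leqP (size (word b)) (size (word a)).
    exact: IH fa gb e.
  rewrite -opprB e; apply: (subspaceN (nspan_subspace _)).
  exact: IH gb fa (esym e).
move=> Sf Sg fa gb e; have [wab|nab] := eqVneq (word a) (word b).
  rewrite wab in e; rewrite -(csg_mulI e).
  exact: same_word_nspan fa gb wab.
set A := word a in le_ba e nab *; set B := word b in le_ba e nab *.
pose L := msetU A B; pose a0 := msetB L A; pose b0 := msetB L B.
have La0 : L = msetD A a0 by rewrite msetBDKC ?msubsetUl.
have Lb0 : L = msetD B b0 by rewrite msetBDKC ?msubsetUr.
pose c := msetB (A · u) L.
have wLc : csg_val (A · u) = msetD L c.
  rewrite msetBDKC //; apply/msubUsetP; split.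
    by apply/msubsetP => x; rewrite /= msetE2 leq_addr.
  by rewrite e; apply/msubsetP => x; rewrite /= msetE2 leq_addr.
have def_u : csg_val u = msetD a0 c.
  apply: (can_inj (msetDKB A)); rewrite msetDA -La0 -wLc //.
have def_v : csg_val v = msetD b0 c.
  by apply: (can_inj (msetDKB B)); rewrite msetDA -Lb0 -wLc e.
have nb0 : b0 != mset0.
  apply: contra nab => /eqP b00; apply/eqP/val_inj/eqP.
  rewrite eqEmsubset.
  have sAB : msubset A B.
    by rewrite -[csg_val B]msetD0 -b00 -Lb0 msubsetUl.
  rewrite sAB /= -msetB_eq0 -size_mset_eq0 -(eqn_add2l (size A)).
  rewrite -size_msetD msetBDKC // addn0 eqn_leq le_ba /=.
  by rewrite -(msetBDKC sAB) size_msetD leq_addr.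
have nL : L != mset0.
  by apply: contraNneq nb0 => L0; rewrite /b0 L0 mset0B.
pose b1 : csg X := Csg nb0.
suff spoly : nspan (wlt (A · u)) (dvo (dvo f a0) c - dvo (g ⊣ b1) c).
  rewrite -[f ⊣ u]dvo_csg -[g ⊣ v]dvo_csg def_u def_v !dvoD.
  by rewrite -[b0]/(csg_val b1) [dvo g b1]dvo_csg.
rewrite -dvoB.
have [I0|nI] := eqVneq (msetI A B) mset0.
  have LE : L = msetD A B by rewrite -msetUI I0 msetD0.
  have a0B : a0 = B by rewrite /a0 LE msetDKB.
  have b1A : b1 = A by apply: val_inj; rewrite /= /b0 LE msetDKBC.
  apply: (@nspan_dvo (A · B)); first by rewrite wLc LE.
  by rewrite a0B dvo_csg b1A; apply: coprime_dv_nspan.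
have sL : (size L < size A + size B)%N.
  rewrite -size_msetD -msetUI size_msetD -[X in (X < _)%N]addn0 ltn_add2l.
  by rewrite lt0n size_mset_eq0.
have [le3|gt3] := leqP (size A + size B) 3; last first.
  apply: (@nspan_dvo (Csg nL)) => //.
  (* If L is the leading word of f and has length 2, then that of g is a
     letter, against the bound on the lengths. *)
  have ca0 : a0 = mset0 -> center a = 1%N.
    move=> a00; have [//|/eqP/center_size sA] := eqVneq (center a) 1%N.
    suff : (size A + size B <= 3)%N by rewrite leqNgt gt3.
    have : (size B < size L)%N.
      rewrite Lb0 size_msetD -[X in (X < _)%N]addn0 ltn_add2l lt0n.
      by rewrite size_mset_eq0.
    by rewrite La0 a00 msetD0 sA ltnS => sB; apply: (leq_add (leqnn 2) sB).
  have fa0 : normal lt f a0 1 (dvo f a0).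
    case: (dvoP f a0) ca0 => [/(_ erefl) <-|a1 _]; last exact: normal_dv fa.
    by apply: normal_nil; apply: (lead_lm lt_mo (strong_lead fa)).
  have fL : strong_at lt (dg1 (Csg nL)) (dvo f a0).
    case: (dvoP f a0) ca0 La0 => [/(_ erefl) ca LA|a1 _ LA].
      have -> : Csg nL = A by apply: val_inj; rewrite /= LA msetD0.
      by rewrite dg1K.
    have -> : Csg nL = A · a1 by apply: val_inj.
    exact: strong_at_dv.
  have gL : strong_at lt (dg1 (Csg nL)) (g ⊣ b1).
    have -> : Csg nL = B · b1 by apply: val_inj.
    exact: strong_at_dv.
  apply: (@composition_nspan _ f g) => //; last 1 first.
  - exact: supp_strong_sub fL gL.
  - apply: (@comp_lcm _ _ _ _ _ A B a0 b1) => //.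
    + exact/(strongP lt_mo (strong_lead fa)).
    + exact/(strongP lt_mo (strong_lead gb)).
    + rewrite (lead_lwsize lt_mo (strong_lead fa)).
      by rewrite (lead_lwsize lt_mo (strong_lead gb)).
    + rewrite (lead_lm lt_mo (strong_lead fa)) (lead_lm lt_mo (strong_lead gb)).
      by apply: contra nab => /eqP[ab]; rewrite /A ab.
    + by rewrite (lead_lw lt_mo (strong_lead fa)).
    + by rewrite (lead_lw lt_mo (strong_lead gb)).
    + exact: normal_dv gb.
  - exact: word_lt_down.
(* The words share a letter and the shorter one is a letter y: it divides the
   other, which has length 2. *)
have [sB sA] : size B = 1%N /\ (size A <= 2)%N.
  have := size_csg_gt0 (word b); rewrite -/B => sB0.
  have sB1 : (size B <= 1)%N.
    rewrite leqNgt; apply: contraL le3 => sB1.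
    by rewrite -ltnNge (leq_add (leq_trans sB1 le_ba) sB1).
  have sB : size B = 1%N by apply/eqP; rewrite eqn_leq sB1.
  by split=> //; rewrite -(leq_add2r 1) -{1}sB.
have [y By] := size1_letter sB.
have yA : y \in csg_val A.
  have [I0|[x]] := mset_0Vmem (msetI A B); first by rewrite I0 eqxx in nI.
  by rewrite in_msetI By in_mset1 => /andP[xA /eqP <-].
have sBA : msubset B A by rewrite By msub1set.
have LA : L = A by apply/msetUidPl.
have a00 : a0 = mset0 by rewrite /a0 LA msetBxx.
have [z b1z] : exists z, b1 = letter z.
  apply: size1_letter; apply/eqP.
  have := congr1 (fun m : {mset X} => size m) Lb0.
  rewrite LA size_msetD sB add1n => eA; rewrite eqn_leq size_csg_gt0 andbT.
  by rewrite -ltnS -eA.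
have wAB : A = B · letter z by rewrite -b1z; apply: val_inj; rewrite /= -Lb0 LA.
have cu : csg_val u = c by rewrite def_u a00 mset0D.
rewrite dvoB -!cu !dvo_csg a00 dvo0 b1z dv_dv.
exact: divides_nspan fa gb sB wAB.
Qed.

(** A normal polynomial f ⊢ x has center 2 and f ⊣ u has center 1, which
    excludes the mixed case. *)
Lemma normal_at_sub_nspan a p q : normal_at lt S a p -> normal_at lt S a q ->
  nspan (fun b => mlt b a) (p - q).
Proof.
have wlt_mlt b h : nspan (wlt (word b)) h -> nspan (fun c => mlt c b) h.
  by apply: nspan_sub => c; apply: mc_word.
have opp b h h' : nspan (fun c => mlt c b) (h - h') ->
    nspan (fun c => mlt c b) (h' - h).
  by rewrite -[h' - h]opprB; apply: (subspaceN (nspan_subspace _)).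
have size2 (x y : X) : size (letter y · letter x) = 2%N :> nat.
  by rewrite size_csg_mul !size_letter.
move=> pa; move def_b: a => b qb; rewrite -def_b.
case: pa def_b => {a p} [f a Sf fa|f x y Sf fy|f a u Sf fa];
  case: qb => {b q} [g b Sg gb|g x' y' Sg gy|g b v Sg gb] e.
- by rewrite -e in gb; apply: same_nspan.
- exact: elt_two_nspan gy e.
- exact: elt_one_nspan gb e.
- by apply: (opp); rewrite e; apply: elt_two_nspan fy (esym e).
- have ew := congr1 (@word X) e; rewrite !word_dg2 in ew.
  by apply: wlt_mlt; rewrite word_dg2; apply: two_two_nspan fy gy ew.
- by case: (@dg1_neq_dg2 _ _ _ (size2 x y) (esym e)).
- by apply: opp; rewrite e; apply: elt_one_nspan fa (esym e).
- by case: (@dg1_neq_dg2 _ _ _ (size2 x' y') e).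
- have ew : word a · u = word b · v := congr1 (@word X) e.
  by apply: wlt_mlt; apply: one_one_nspan fa gb ew.
Qed.

(** * The Composition-Diamond lemma *)

Definition mle a b : Prop := b = a \/ mlt b a.

Lemma nspan_max (A : disgp X -> Prop) h : nspan A h ->
  h = 0 \/ exists2 b, A b & nspan (mle b) h.
Proof.
pose W g := g = 0 \/ exists2 b, A b & nspan (mle b) g.
apply: (@nspan_ind A W) => [|a p pa Aa]; last first.
  by right; exists a => //; apply: nspan_gen pa _; left.
have mle_trans b c d : mlt c b -> mle c d -> mle b d.
  by move=> cb [->|dc]; right=> //; apply: mc_trans dc cb.
split=> [|c u v]; first by left.
case=> [->|[a Aa ua]]; first by rewrite scaler0 add0r.
case=> [->|[b Ab vb]].
  right; exists a => //; rewrite addr0.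
  exact: subspaceZ (nspan_subspace _) _ _ ua.
right; have [ab|[ab|ba]] := mc_total lt_mo a b.
- by exists b => //; rewrite ab in ua; apply: (nspan_subspace _).2.
- exists b => //; apply: (nspan_subspace _).2 => //.
  by apply: nspan_sub ua => d; apply: mle_trans.
- exists a => //; apply: (nspan_subspace _).2 => //.
  by apply: nspan_sub vb => d; apply: mle_trans.
Qed.

Lemma nspan_lt_supp a h : nspan (fun b => mlt b a) h ->
  supp_in (fun b => mlt b a) h.
Proof.
apply: nspan_ind (supp_in_subspace _) _ _ => c p pc ca b.
case/(lead_supp (normal_at_lead lt_mo pc)) => [->//|bc].
exact: mc_trans bc ca.
Qed.

(** Well-founded induction on a bound a for the leading monomials used in h.
    Modulo normal polynomials below a, all those with leading monomial a agree
    with a single one, p, so h is c p plus smaller ones.  If c is nonzero, a is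
    the leading monomial of h; otherwise the bound can be lowered. *)
Lemma composition_diamond h : nspan (fun=> True) h -> h <> 0 ->
  exists a p, normal_at lt S a p /\ lm lt h = Some a.
Proof.
move=> /nspan_max[-> //|[b _]].
elim/(well_founded_ind (mc_wf lt_mo)): b h => a IHa h ha h0.
have reduce : nspan (fun b => mlt b a) h ->
    exists b q, normal_at lt S b q /\ lm lt h = Some b.
  by case/nspan_max => [//|[b ba hb]]; apply: IHa hb h0.
have [[p pa]|no_p] := pselect (exists p, normal_at lt S a p); last first.
  apply: reduce; apply: nspan_ind ha; first exact: nspan_subspace.
  move=> b p pb [ba|ba]; last exact: nspan_gen pb ba.
  by case: no_p; exists p; rewrite -ba.
have [c hc] : exists c : k, nspan (fun b => mlt b a) (h - c *: p).
  pose W g := exists c : k, nspan (fun b => mlt b a) (g - c *: p).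
  apply: (@nspan_ind _ W _ _ h ha).
    split=> [|c u v [cu Hu] [cv Hv]].
      by exists 0; rewrite scale0r subrr; apply: subspace0 (nspan_subspace _).
    exists (c * cu + cv).
    have -> : c *: u + v - (c * cu + cv) *: p
            = c *: (u - cu *: p) + (v - cv *: p).
      by rewrite scalerBr scalerA scalerDl opprD addrACA.
    exact: ((nspan_subspace _).2 c _ _ Hu Hv).
  move=> b q qb [ba|ba].
    exists 1; rewrite scale1r; rewrite ba in qb; exact: normal_at_sub_nspan.
  by exists 0; rewrite scale0r subr0; apply: nspan_gen qb ba.
have [c0|c0] := eqVneq c 0.
  by apply: reduce; rewrite c0 scale0r subr0 in hc.
exists a, p; split=> //; rewrite -(lmZ lt _ (invr_neq0 c0)).
apply: lead_lm => //.
have pa' := normal_at_lead lt_mo pa.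
have -> : c^-1 *: h = p + c^-1 *: (h - c *: p).
  by rewrite scalerBr scalerA mulVf // scale1r addrC subrK.
rewrite /lead addrAC; apply: (subspaceD (supp_in_subspace _)) => //.
by apply: (subspaceZ (supp_in_subspace _)); apply: nspan_lt_supp.
Qed.

Lemma nspan_ideal_dv h u : nspan (fun=> True) h -> nspan (fun=> True) (h ⊣ u).
Proof.
have subW := nspan_subspace (fun=> True).
apply: nspan_ind (subspace_comp (dv_linear u) subW) _ _ => a p pa _.
by apply: nspan_sub (normal_at_dv pa).
Qed.

Lemma nspan_ideal_vd h u : nspan (fun=> True) h -> nspan (fun=> True) (h ⊢ u).
Proof.
have subW := nspan_subspace (fun=> True).
apply: nspan_ind (subspace_comp (vd_linear u) subW) _ _ => a p pa _.
by apply: nspan_sub (normal_at_vd pa).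
Qed.

Lemma nspan_congruence :
  congruence (@vdash X) (@dvash X)
    (fun a b => nspan (fun=> True) (mono a - mono b)).
Proof.
have trans a b c : nspan (fun=> True) (mono a - mono b) ->
    nspan (fun=> True) (mono b - mono c) ->
    nspan (fun=> True) (mono a - mono c).
  rewrite -[mono a - mono c](subrKA (mono b)).
  exact: (subspaceD (nspan_subspace _)).
split=> //.
- by move=> a; rewrite subrr; apply: subspace0 (nspan_subspace _).
- move=> a b; rewrite -[mono b - _]opprB.
  exact: (subspaceN (nspan_subspace _)).
- move=> a a' b b' aa' bb'; apply: (trans _ (vdash a' b)).
    by have := nspan_ideal_vd (word b) aa'; rewrite vdB !vdU.
  have := nspan_ideal_vd (word a') bb'; rewrite vdB !vdU.
  by rewrite /vdash ![word a' · _]csg_mulC.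
- move=> a a' b b' aa' bb'; apply: (trans _ (dvash a' b)).
    by have := nspan_ideal_dv (word b) aa'; rewrite dvB !dvU.
  have := nspan_ideal_dv (word a') bb'; rewrite dvB !dvU.
  by rewrite /dvash ![word a' · _]csg_mulC.
Qed.

End GroebnerShirshovBasis.

(** * The ideal of a congruence *)

Section CongruenceIdeal.
Variables (X : choiceType) (k : fieldType) (lt : rel (csg X)).
Local Notation Di := {malg k[disgp X]}.
Variable S : set (disgp X * disgp X).

Definition congruence_ideal : Di -> Prop :=
  span (fun p => exists a b, rho S a b /\ p = mono a - mono b).

Lemma congruence_ideal_subspace : subspace congruence_ideal.
Proof. exact: span_subspace. Qed.

Lemma congruence_ideal_sub a b :
  rho S a b -> congruence_ideal (mono a - mono b).
Proof. by move=> ab; apply: span_gen; exists a, b. Qed.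

Lemma congruence_ideal_dv f u : congruence_ideal f -> congruence_ideal (f ⊣ u).
Proof.
apply: (span_min (subspace_comp (dv_linear u) congruence_ideal_subspace)).
move=> p [a [b [ab ->]]]; rewrite dvB !dvU; apply: congruence_ideal_sub.
have cS := rho_congruence S.
exact: (cong_dv cS ab (cong_refl cS (dg1 u))).
Qed.

Lemma congruence_ideal_vd f u : congruence_ideal f -> congruence_ideal (f ⊢ u).
Proof.
apply: (span_min (subspace_comp (vd_linear u) congruence_ideal_subspace)).
move=> p [a [b [ab ->]]]; rewrite vdB !vdU; apply: congruence_ideal_sub.
have cS := rho_congruence S.
exact: (cong_vd cS ab (cong_refl cS (dg1 u))).
Qed.

Lemma congruence_ideal_normal f u m p :
  congruence_ideal f -> normal lt f u m p -> congruence_ideal p.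
Proof.
move=> If; case=> [//|x _|b _].
  by rewrite vdE; apply: congruence_ideal_vd.
by rewrite dvE; apply: congruence_ideal_dv.
Qed.

Lemma congruence_ideal_composition f g h : congruence_ideal f ->
  congruence_ideal g -> composition lt f g h -> congruence_ideal h.
Proof.
move=> If Ig; have subI := subspaceB congruence_ideal_subspace.
case=> [x _|x _|x y _ _ _|_ _|x m p _ _ gp _|x p q _ _ _ _ _ fp gq|].
- by rewrite vdE; apply: congruence_ideal_vd.
- by rewrite dvE; apply: congruence_ideal_dv.
- rewrite vdE dvE; apply: subI.
    exact: congruence_ideal_vd.
  exact: congruence_ideal_dv.
- exact: subI.
- by apply: subI => //; apply: congruence_ideal_normal gp.
- apply: subI; first exact: congruence_ideal_normal fp.
  exact: congruence_ideal_normal gq.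
move=> u v m b p q _ _ _ _ _ _ _ _ _ _ fp gq.
apply: subI; first exact: congruence_ideal_normal fp.
exact: congruence_ideal_normal gq.
Qed.

(** The algorithm only adds multiples of compositions, so it never leaves an
    ideal containing the binomials. *)
Lemma bs_comp_congruence_ideal f :
  bs_comp lt (binomials k S) f -> congruence_ideal f.
Proof.
case=> n; elim: n f => [f [p Sp <-]|n IHn f /=].
  have -> : << p.1 >> - << p.2 >> = mono p.1 - mono p.2 :> Di by rewrite unlock.
  by apply: congruence_ideal_sub => R _; apply.
case=> [/IHn //|[h [[g [g' [Sg [Sg' gg'h]]]] _] <-]].
apply: (subspaceZ congruence_ideal_subspace).
by apply: congruence_ideal_composition gg'h; apply: IHn.
Qed.

(** The coordinate at c of the image in the algebra of the quotient
    disemigroup. *)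
Definition class_sum (c : disgp_pres S) : Di -> k^o :=
  lext (fun a => (`[< pres_pi S a = c >])%:R : k^o).

Lemma class_sum_mono c a : class_sum c (mono a) = (`[< pres_pi S a = c >])%:R.
Proof. exact: lextU. Qed.

Lemma class_sum_linear c : linear (class_sum c).
Proof. exact: lext_linear. Qed.

Lemma class_sum_ideal c f : congruence_ideal f -> class_sum c f = 0.
Proof.
apply: (span_min (subspace_comp (class_sum_linear c) (zero_subspace _))).
move=> p [a [b [/pres_piP ab ->]]].
by rewrite (linear_sub _ _ (class_sum_linear c)) !class_sum_mono ab subrr.
Qed.

End CongruenceIdeal.

(** * Normal forms *)

Section NormalForms.
Variables (X : choiceType) (k : fieldType) (lt : rel (csg X)).
Hypothesis lt_mo : monomial_ordering lt.
Local Notation Di := {malg k[disgp X]}.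
Variable S : set (disgp X * disgp X).
Hypothesis S_lt : forall p, S p -> mc_lt lt p.2 p.1.
Local Notation T := (bs_comp lt (binomials k S)).

Lemma binomial_lead p : S p ->
  lead lt p.1 (<< p.1 >> - << p.2 >> : Di).
Proof.
move=> Sp.
have -> : << p.1 >> - << p.2 >> = mono p.1 - mono p.2 :> Di by rewrite unlock.
rewrite /lead addrAC subrr add0r; apply: (subspaceN (supp_in_subspace _)).
by apply: supp_inU; apply: S_lt.
Qed.

Lemma bs_comp_binomials_gs : gs_basis lt T.
Proof.
apply: bs_comp_gs_basis => f [p Sp <-].
have pa := binomial_lead Sp.
by rewrite /Defs.monic /lc (lead_lm lt_mo pa) (lead_coeff lt_mo pa).
Qed.

Lemma rho_nspan a b : rho S a b -> nspan lt T (fun=> True) (mono a - mono b).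
Proof.
move=> ab; apply: (ab _ (nspan_congruence lt_mo bs_comp_binomials_gs)) => {ab}.
move=> p Sp.
have -> : mono p.1 - mono p.2 = << p.1 >> - << p.2 >> :> Di by rewrite unlock.
apply: nspan_gen (normal_at_elt _ (binomial_lead Sp)) _ => //.
by exists 0%N; exists p.
Qed.

Lemma Irr_unique a b : Irr lt T a -> Irr lt T b -> rho S a b -> a = b.
Proof.
move=> Ia Ib ab; apply: contrapT => nab.
have h0 : mono a - mono b <> 0 :> Di.
  move=> /(congr1 (mcoeff a)); rewrite mcoeffB !mcoeff_mono eqxx mcoeff0.
  have [//|_] := eqVneq a b.
  by rewrite subr0 => /eqP; rewrite oner_eq0.
have [c [p [pc hc]]] :=
  composition_diamond lt_mo bs_comp_binomials_gs (rho_nspan ab) h0.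
have cI : ~ Irr lt T c.
  apply; exists p; first exact: normal_at_in pc.
  by apply: lead_lm => //; apply: normal_at_lead pc.
have : supp_in (fun d => d = a \/ d = b) (mono a - mono b : Di).
  by apply: (subspaceB (supp_in_subspace _)); apply: supp_inU; [left|right].
by move=> /(_ c (lm_supp hc)) [ca|cb]; apply: cI; rewrite ?ca ?cb.
Qed.

(** Otherwise the coefficient sum over the class c, which vanishes on normal
    polynomials, would vanish on every monomial a: it does so on irreducible
    ones, and a reducible a is a normal polynomial minus smaller monomials.
    Yet it is 1 on the elements of c. *)
Lemma Irr_exists (c : disgp_pres S) : exists2 a, Irr lt T a & pres_pi S a = c.
Proof.
apply: contrapT => noI.
suff phi0 a : class_sum c (mono a : Di) = 0.
  have := phi0 (repr c); rewrite class_sum_mono /pres_pi reprK asboolT //.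
  by move/eqP; rewrite oner_eq0.
elim/(well_founded_ind (mc_wf lt_mo)): a => a IHa.
have [Ia|nI] := pselect (Irr lt T a).
  by rewrite class_sum_mono asboolF // => ac; apply: noI; exists a.
have [p Np pa] : exists2 p, normal_in lt T p & lm lt p = Some a.
  by apply: contrapT.
have [b pb] := normal_in_at lt_mo (gs_monic bs_comp_binomials_gs) Np.
have lead_p := normal_at_lead lt_mo pb.
have ba : b = a by have := lead_lm lt_mo lead_p; rewrite pa => -[].
rewrite ba in lead_p.
have p0 : class_sum c p = 0.
  apply: class_sum_ideal; have [f [u [m [Tf fp]]]] := Np.
  exact: congruence_ideal_normal (bs_comp_congruence_ideal Tf) fp.
have r0 : class_sum c (p - mono a) = 0.
  exact: (linear_supp (class_sum_linear c) (zero_subspace _) lead_p IHa).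
by rewrite -[mono a](subKr p) (linear_sub _ _ (class_sum_linear c)) p0 r0 subr0.
Qed.

End NormalForms.

Theorem theorem28 (d : Order.disp_t) (X : orderType d) (k : fieldType)
    (lt : rel (csg X)) (lt_mo : monomial_ordering lt)
    (S : set (disgp X * disgp X))
    (S_lt : forall p, S p -> mc_lt lt p.2 p.1) :
  forall c : disgp_pres S,
    exists! a : disgp X, Irr lt (bs_comp lt (binomials k S)) a /\ pres_pi S a = c.
Proof.
move=> c; have [a Ia ac] := Irr_exists k lt_mo S_lt c.
exists a; split=> // b [Ib bc].
by apply: (Irr_unique lt_mo S_lt Ia Ib); apply/pres_piP; rewrite ac bc.
Qed.
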